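(* Let $\widehat{G}$ be a group with identity element $e$, let $G\leq\widehat{G}$ be a subgroup, and let $S=\bigoplus_{g\in G}S_g$ be a strongly $G$-graded unital ring with principal component $R:=S_e$ and Picard homomorphism $p:G\to\mathrm{Pic}(R)$, $g\mapsto[S_g]$. Let $\widehat{p}:\widehat{G}\to\mathrm{Pic}(R)$ be a group homomorphism extending $p$. Then there exists a $\widehat{G}$-lift of $S$ with Picard homomorphism $\widehat{p}$ if and only if the characteristic class $\kappa_S(\widehat{p})\in H^3_{\widehat{p}}(\widehat{G},G;\mathrm{U}(Z(R)))$ is trivial, i.e. $\kappa_S(\widehat{p})=0$.
   Context: All rings are associative and unital, ring homomorphisms and module actions are unital; no commutativity is assumed. For a group $H$ with identity $e$, an $H$-grading on a ring $A$ is a family $(A_h)_{h\in H}$ of additive subgroups with $A=\bigoplus_{h}A_h$ and $A_hA_k\subseteq A_{hk}$; it is strong if $A_hA_k=A_{hk}$ for all $h,k\in H$. The principal component is $A_e$. An $R$-bimodule $M$ is invertible if there is an $R$-bimodule $N$ with $M\otimes_R N\cong R\cong N\otimes_R M$ as bimodules. $\mathrm{Pic}(R)$ is the group of isomorphism classes $[M]$ of invertible $R$-bimodules under $[M][N]=[M\otimes_R N]$. If $A$ is strongly $H$-graded with $A_e=R$, each $A_h$ is an invertible $R$-bimodule, multiplication induces $R$-bimodule isomorphisms $A_h\otimes_R A_k\to A_{hk}$, and the Picard homomorphism of $A$ is the group homomorphism $H\to\mathrm{Pic}(R)$, $h\mapsto[A_h]$. A $\widehat{G}$-lift of $S$ is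 a strongly $\widehat{G}$-graded unital ring $\widehat{S}=\bigoplus_{x\in\widehat{G}}\widehat{S}_x$ containing $S$ as a unital subring with $\widehat{S}_g=S_g$ for all $g\in G$. $Z(R)$ is the center of $R$ and $\mathrm{U}(Z(R))$ its group of units. For an invertible $R$-bimodule $M$ there is a unique $\Delta_M\in\mathrm{Aut}(Z(R))$ with $mz=\Delta_M(z)m$ for all $m\in M$, $z\in Z(R)$; it depends only on $[M]$, and $[M]\mapsto\Delta_M$ is a group homomorphism $\mathrm{Pic}(R)\to\mathrm{Aut}(Z(R))$. Via $\widehat{p}$, $\widehat{G}$ acts on $\mathrm{U}(Z(R))$ by ${}^xu=\Delta_{\widehat{p}(x)}(u)$. Relative cohomology: let $C^n_{\widehat{p}}(\widehat{G},\mathrm{U}(Z(R)))$ be the group of normalized $n$-cochains (maps $\widehat{G}^n\to\mathrm{U}(Z(R))$ equal to $1$ whenever some argument is $e$) for this action, with the usual (multiplicatively written) group cohomology differential $d$. The relative complex $C^\bullet_{\widehat{p}}(\widehat{G},G;\mathrm{U}(Z(R)))$ is the kernel of the restriction of cochains from $\widehat{G}$ to $G$, so for $n\ge1$ it consists of the $c$ with $c|_{G^n}=1$. Its cohomology is denoted $H^n_{\widehat{p}}(\widehat{G},G;\mathrm{U}(Z(R)))$, $n\geq 1$. Characteristic class: for each $x\in\widehat{G}$ choose an invertible $R$-bimodule $M_x$ representing $\widehat{p}(x)$, with $M_g=S_g$ for all $g\in G$ (so $M_e=R$). For all $x,y\in\widehat{G}$ choose $R$-bimodule isomorphisms $\mu_{x,y}:M_x\otimes_R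 M_y\to M_{xy}$ such that $\mu_{g,h}$ is the multiplication map $S_g\otimes_R S_h\to S_{gh}$ of $S$ for $g,h\in G$, and $\mu_{e,x},\mu_{x,e}$ are the canonical module actions for all $x\in\widehat{G}$. Such choices exist. For $x,y,z\in\widehat{G}$ there is a unique $\alpha(x,y,z)\in\mathrm{U}(Z(R))$ with $$\mu_{xy,z}\circ(\mu_{x,y}\otimes\mathrm{id}_{M_z})=\alpha(x,y,z)\,\mu_{x,yz}\circ(\mathrm{id}_{M_x}\otimes\mu_{y,z}).$$ The map $\alpha$ is a normalized relative $3$-cocycle whose class does not depend on the choices, and $\kappa_S(\widehat{p}):=[\alpha]\in H^3_{\widehat{p}}(\widehat{G},G;\mathrm{U}(Z(R)))$. *)

(* Defs.v *)
From HB Require Import structures.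
From mathcomp Require Import all_boot all_algebra ring_quotient.
From mathcomp Require Import boolp classical_sets.
From mathcomp Require Import freeg.

Set Implicit Arguments.
Unset Strict Implicit.
Unset Printing Implicit Defensive.

Import GRing.Theory Quotient.

Local Open Scope classical_set_scope.
Local Open Scope ring_scope.
Local Open Scope quotient_scope.

Reserved Notation "m '*t' n" (at level 40, left associativity).

HB.mixin Record Lmodule_isBimodule (R : pzRingType) M
    of GRing.Lmodule R M := {
  rscale : M -> R -> M;
  rscalerA : forall m a b, rscale (rscale m a) b = rscale m (a * b);
  rscaler1 : forall m, rscale m 1 = m;
  rscalerDl : forall a, {morph rscale^~ a : m n / m + n};
  rscalerDr : forall m, {morph rscale m : a b / a + b};
  scale_rscale : forall a m b, rscale (a *: m) b = a *: rscale m b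
}.

#[short(type="bimodType")]
HB.structure Definition Bimodule (R : pzRingType) :=
  {M of GRing.Lmodule R M & Lmodule_isBimodule R M}.

Notation "m :* r" := (rscale m r) : ring_scope.

Definition is_bimod_iso (R : pzRingType) (M N : bimodType R) (f : M -> N) :=
  [/\ linear f, forall m r, f (m :* r) = f m :* r & bijective f].

Definition bimod_iso (R : pzRingType) (M N : bimodType R) : Prop :=
  exists f : M -> N, is_bimod_iso f.

HB.instance Definition _ (R : pzRingType) :=
  Lmodule_isBimodule.Build R R^o
    (fun (m : R) a b => esym (mulrA m a b)) (@mulr1 R)
    (fun a (m n : R) => mulrDl m n a) (@mulrDr R)
    (fun (a m b : R) => esym (mulrA a m b)).

Section Tensor.
Variables (R : pzRingType) (M N : bimodType R).
Local Notation F := {freeg (M * N)%type / int}.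

Inductive tensor_ker : F -> Prop :=
| TkerDl m1 m2 n : tensor_ker (<<(m1 + m2, n)>> - <<(m1, n)>> - <<(m2, n)>>)
| TkerDr m n1 n2 : tensor_ker (<<(m, n1 + n2)>> - <<(m, n1)>> - <<(m, n2)>>)
| TkerM m r n : tensor_ker (<<(m :* r, n)>> - <<(m, r *: n)>>)
| Tker0 : tensor_ker 0
| TkerB x y : tensor_ker x -> tensor_ker y -> tensor_ker (x - y).

Definition tensor_kerb : {pred F} := fun x => `[< tensor_ker x >].

Fact tensor_ker_zmod : zmod_closed tensor_kerb.
Proof.
split=> [|x y /asboolP kx /asboolP ky]; apply/asboolP; first exact: Tker0.
exact: TkerB.
Qed.

HB.instance Definition _ :=
  GRing.isZmodClosed.Build F tensor_kerb tensor_ker_zmod.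

Definition tensor := {quot tensor_kerb}.
HB.instance Definition _ := GRing.Zmodule.on tensor.

Definition tens (m : M) (n : N) : tensor := \pi_tensor <<(m, n)>>.

End Tensor.
Notation "m *t n" := (tens m n) : ring_scope.

Section TensorLift.
Variables (R : pzRingType) (M N : bimodType R) (V : zmodType).

Definition balanced (f : M -> N -> V) :=
  [/\ forall n, {morph f^~ n : a b / a + b}, forall m, {morph f m : a b / a + b}
    & forall m r n, f (m :* r) n = f m (r *: n)].

(* The additive map [m *t n |-> f m n], for balanced [f]. *)
Definition tlift (f : M -> N -> V) (t : tensor M N) : V :=
  fglift (fun p : M * N => f p.1 p.2 : zmodule V) (repr t).

Variables (f : M -> N -> V) (bal_f : balanced f).

Let g := fglift (fun p : M * N => f p.1 p.2 : zmodule V).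

Let gB : {morph g : x y / x - y}.
Proof. exact: lift_is_additive. Qed.

Let gU m n : g <<(m, n)>> = f m n.
Proof. by rewrite /g liftU scale1r. Qed.

Let g_ker x : tensor_ker x -> g x = 0.
Proof.
case: bal_f => fDl fDr fM; elim=> {x} [m1 m2 n|m n1 n2|m r n||x y _ gx _ gy].
- by rewrite !gB !gU fDl addrAC addrK subrr.
- by rewrite !gB !gU fDr addrAC addrK subrr.
- by rewrite gB !gU fM subrr.
- by rewrite -(subrr 0) gB subrr.
- by rewrite gB gx gy subrr.
Qed.

Let tlift_pi x : tlift f (\pi_(tensor M N) x) = g x.
Proof.
have : (repr (\pi_(tensor M N) x) - x) \in @tensor_kerb R M N.
  by rewrite idealrBE reprK.
move/asboolP/g_ker; rewrite gB => /eqP; rewrite subr_eq0 => /eqP.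
exact.
Qed.

Lemma tlift_zmod : zmod_morphism (tlift f).
Proof.
move=> x y; rewrite -[x]reprK -[y]reprK -raddfB !tlift_pi; exact: gB.
Qed.

Lemma tliftD : {morph tlift f : x y / x + y}.
Proof.
have t0 : tlift f 0 = 0 by have := tlift_zmod 0 0; rewrite !subrr.
by move=> x y; rewrite -{1}[y]opprK tlift_zmod -[- y]sub0r tlift_zmod t0 sub0r opprK.
Qed.

Lemma tliftE m n : tlift f (m *t n) = f m n.
Proof. by rewrite /tens tlift_pi gU. Qed.

End TensorLift.

Section TensorTheory.
Variables (R : pzRingType) (M N : bimodType R).
Implicit Types (m : M) (n : N).

Let piB x y : \pi_(tensor M N) (x - y) = \pi_(tensor M N) x - \pi_(tensor M N) y.
Proof. exact: raddfB. Qed.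

Let pi_ker x : tensor_ker x -> \pi_(tensor M N) x = 0.
Proof.
move=> kx; have /eqP -> // : x == 0 %[mod tensor M N].
  by rewrite -idealrBE subr0; apply/asboolP.
by rewrite raddf0.
Qed.

Lemma tensDl m1 m2 n : (m1 + m2) *t n = m1 *t n + m2 *t n.
Proof.
have := pi_ker (TkerDl m1 m2 n); rewrite !piB -addrA -opprD => /eqP.
by rewrite subr_eq0 => /eqP.
Qed.

Lemma tensDr m n1 n2 : m *t (n1 + n2) = m *t n1 + m *t n2.
Proof.
have := pi_ker (TkerDr m n1 n2); rewrite !piB -addrA -opprD => /eqP.
by rewrite subr_eq0 => /eqP.
Qed.

Lemma tensM m r n : (m :* r) *t n = m *t (r *: n).
Proof.
by have := pi_ker (TkerM m r n); rewrite piB => /eqP; rewrite subr_eq0 => /eqP.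
Qed.

Lemma tens0l n : 0 *t n = 0 :> tensor M N.
Proof. by apply: (addIr (0 *t n)); rewrite -tensDl !add0r. Qed.

Lemma tensNl m n : (- m) *t n = - (m *t n).
Proof. by apply/eqP; rewrite -subr_eq0 opprK -tensDl addNr tens0l. Qed.

Lemma tens_ind (P : tensor M N -> Prop) :
  P 0 -> (forall x y, P x -> P y -> P (x + y)) -> (forall m n, P (m *t n)) ->
  forall t, P t.
Proof.
move=> P0 PD Pt t; rewrite -[t]reprK -[repr t]freeg_sumE raddf_sum /=.
apply: (big_ind P) => // -[m n] _; set c := coeff _ _.
have Pn k m' : P (m' *t n *+ k).
  elim: k => [|k IHk]; first by rewrite mulr0n.
  by rewrite mulrS; apply: PD.
suff -> : \pi_(tensor M N) << c *g (m, n)>> = (m *t n) *~ c.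
  case: c => k; first exact: Pn.
  by rewrite NegzE -nmulrn -mulNrn -tensNl; apply: Pn.
by rewrite -raddfMz freegU_mulz intz.
Qed.

Lemma tlift_eq (V : zmodType) (f g : tensor M N -> V) :
  {morph f : x y / x + y} -> {morph g : x y / x + y} ->
  (forall m n, f (m *t n) = g (m *t n)) -> f =1 g.
Proof.
move=> fD gD fg; apply: tens_ind => [|x y fx fy|//]; last by rewrite fD gD fx fy.
have f0 : f 0 = 0 by apply: (addIr (f 0)); rewrite -fD !add0r.
by rewrite f0; apply: (addIr (g 0)); rewrite -gD !add0r.
Qed.

Definition tens_scale (r : R) : tensor M N -> tensor M N :=
  tlift (fun m n => (r *: m) *t n).
Definition tens_rscale (t : tensor M N) (r : R) : tensor M N :=
  tlift (fun m n => m *t (n :* r)) t.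

Let lbal r : balanced (fun m n => (r *: m) *t n).
Proof.
split=> [n a b|m a b|m s n]; first by rewrite scalerDr tensDl.
  by rewrite tensDr.
by rewrite -scale_rscale tensM.
Qed.

Let rbal r : balanced (fun m n => m *t (n :* r)).
Proof.
split=> [n a b|m a b|m s n]; first by rewrite tensDl.
  by rewrite rscalerDl tensDr.
by rewrite tensM scale_rscale.
Qed.

Let lD r : {morph tens_scale r : x y / x + y}. Proof. exact: tliftD. Qed.
Let rD r : {morph tens_rscale^~ r : x y / x + y}.
Proof. by move=> x y; apply: tliftD. Qed.
Let lE r m n : tens_scale r (m *t n) = (r *: m) *t n. Proof. exact: tliftE. Qed.
Let rE r m n : tens_rscale (m *t n) r = m *t (n :* r). Proof. exact: tliftE. Qed.

Fact tens_scaleA a b t : tens_scale a (tens_scale b t) = tens_scale (a * b) t.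
Proof.
by move: t; apply: tlift_eq => [x y|x y|m n]; rewrite ?lD ?lE ?scalerA.
Qed.

Fact tens_scale1 : left_id 1 tens_scale.
Proof. by apply: tlift_eq => [x y|x y|m n]; rewrite ?lD ?lE ?scale1r. Qed.

Fact tens_scaleDr : right_distributive tens_scale +%R.
Proof. exact: lD. Qed.

Fact tens_scaleDl t : {morph tens_scale^~ t : a b / a + b}.
Proof.
move=> a b; move: t; apply: tlift_eq => [x y|x y|m n].
- exact: lD.
- by rewrite !lD addrACA.
- by rewrite !lE scalerDl tensDl.
Qed.

HB.instance Definition _ := GRing.Zmodule_isLmodule.Build R (tensor M N)
  tens_scaleA tens_scale1 tens_scaleDr tens_scaleDl.

Fact tens_rscaleA t a b : tens_rscale (tens_rscale t a) b = tens_rscale t (a * b).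
Proof.
by move: t; apply: tlift_eq => [x y|x y|m n]; rewrite ?rD ?rE ?rscalerA.
Qed.

Fact tens_rscale1 t : tens_rscale t 1 = t.
Proof. by move: t; apply: tlift_eq => [x y|x y|m n]; rewrite ?rD ?rE ?rscaler1. Qed.

Fact tens_rscaleDr t : {morph tens_rscale t : a b / a + b}.
Proof.
move=> a b; move: t; apply: tlift_eq => [x y|x y|m n].
- exact: rD.
- by rewrite !rD addrACA.
- by rewrite !rE rscalerDr tensDr.
Qed.

Fact tens_scale_rscale a t b :
  tens_rscale (a *: t) b = a *: tens_rscale t b.
Proof.
move: t; apply: tlift_eq => [x y|x y|m n].
- by rewrite scalerDr rD.
- by rewrite rD scalerDr.
- by rewrite rE; change (tens_rscale (tens_scale a (m *t n)) b =
    tens_scale a (m *t (n :* b))); rewrite !lE rE.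
Qed.

HB.instance Definition _ := Lmodule_isBimodule.Build R (tensor M N)
  tens_rscaleA tens_rscale1 rD tens_rscaleDr tens_scale_rscale.

Lemma scale_tens r m n : r *: (m *t n) = (r *: m) *t n.
Proof. exact: lE. Qed.

Lemma tens_rscaleE m n r : (m *t n) :* r = m *t (n :* r).
Proof. exact: rE. Qed.

End TensorTheory.

Definition invertible (R : pzRingType) (M : bimodType R) : Prop :=
  exists N : bimodType R,
    bimod_iso (tensor M N) R^o /\ bimod_iso (tensor N M) R^o.

(* Classes of bimodules are predicates, [set] being bound to a smaller
   universe. *)
Definition iso_class (R : pzRingType) (M : bimodType R) : bimodType R -> Prop :=
  fun N => bimod_iso M N.

Record Pic (R : pzRingType) := MkPic {
  pic_class :> bimodType R -> Prop;
  pic_classP : exists M, invertible M /\ pic_class = iso_class M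
}.

(* The class [M][N] = [M *t N], for M in C and N in D. *)
Definition class_mul (R : pzRingType) (C D : bimodType R -> Prop) :
    bimodType R -> Prop :=
  fun T => exists M N : bimodType R, [/\ C M, D N & bimod_iso (tensor M N) T].

Definition is_pic_hom (H : groupType) (R : pzRingType) (p : H -> Pic R) : Prop :=
  pic_class (p 1%g) = iso_class R^o /\
  forall x y, pic_class (p (x * y)%g) = class_mul (p x) (p y).

Definition pic_rep (R : pzRingType) (C : Pic R) : bimodType R :=
  projT1 (cid (pic_classP C)).

Lemma pic_repP (R : pzRingType) (C : Pic R) :
  invertible (pic_rep C) /\ pic_class C = iso_class (pic_rep C).
Proof. exact: (projT2 (cid (pic_classP C))). Qed.

Definition center (R : pzRingType) : set R := [set z | forall r, z * r = r * z].

Definition center_units (R : pzRingType) : set R :=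
  [set u | center u /\ exists2 v, center v & u * v = 1].

Definition Delta (R : pzRingType) (M : bimodType R) (z : R) : R :=
  xget z [set w | center w /\ forall m : M, m :* z = w *: m].

Section DeltaTheory.
Variables (R : pzRingType) (M : bimodType R) (invM : invertible M).

Lemma morphD0 (U V : zmodType) (f : U -> V) : {morph f : x y / x + y} -> f 0 = 0.
Proof. by move=> fD; apply: (addIr (f 0)); rewrite -fD !add0r. Qed.

Lemma linD (U V : bimodType R) (f : U -> V) :
  is_bimod_iso f -> {morph f : x y / x + y}.
Proof. by case=> fL _ _ x y; have := fL 1 x y; rewrite !scale1r. Qed.

Lemma linZ (U V : bimodType R) (f : U -> V) :
  is_bimod_iso f -> forall r x, f (r *: x) = r *: f x.
Proof.
move=> fI r x; have f0 := morphD0 (linD fI); case: fI => fL _ _.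
by have := fL r x 0; rewrite !addr0 f0 addr0.
Qed.

Lemma invertible_faithful (z : R) : (forall m : M, z *: m = 0) -> z = 0.
Proof.
case: invM => N [[phi phiI] _] zM; have [_ _ [psi _ psiK]] := phiI.
rewrite -[z]mulr1 -[1](psiK 1) -[LHS](linZ phiI z (psi 1)).
suff -> : z *: psi 1 = 0 by rewrite (morphD0 (linD phiI)).
move: (psi 1); apply: tlift_eq => [||m n]; first exact: scalerDr.
  by move=> x y; rewrite addr0.
by rewrite scale_tens zM tens0l.
Qed.

Lemma Delta_exists (z : R) :
  center z -> exists w, center w /\ forall m : M, m :* z = w *: m.
Proof.
move=> cz; case: invM => N [[phi phiI] [psi psiI]].
have [_ phiR [phi' phi'K phiK]] := phiI.
have bal : balanced (fun (m : M) (n : N) => (m :* z) *t n).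
  split=> [n a b|m a b|m r n]; first by rewrite rscalerDl tensDl.
    by rewrite tensDr.
  by rewrite -tensM !rscalerA cz.
pose f := tlift (fun (m : M) (n : N) => (m :* z) *t n).
have fD : {morph f : x y / x + y} := tliftD bal.
have fE m n : f (m *t n) = (m :* z) *t n by apply: tliftE.
have fZ r t : f (r *: t) = r *: f t.
  move: t; apply: tlift_eq => [x y|x y|m n]; rewrite ?scalerDr ?fD ?scalerDr //.
  by rewrite scale_tens !fE scale_rscale scale_tens.
have fR r t : f (t :* r) = f t :* r.
  move: t; apply: tlift_eq => [x y|x y|m n]; rewrite ?rscalerDl ?fD ?rscalerDl //.
  by rewrite tens_rscaleE !fE tens_rscaleE.
pose t1 := phi' 1; have t1E : phi t1 = 1 := phiK 1.
have tZ t : t = (phi t : R) *: t1.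
  by apply: (can_inj phi'K); rewrite (linZ phiI) t1E [RHS]mulr1.
have tR t : t = t1 :* (phi t : R).
  by apply: (can_inj phi'K); rewrite phiR t1E [RHS]mul1r.
pose w : R := phi (f t1).
have wl t : phi (f t) = phi t * w by rewrite {1}[t]tZ fZ (linZ phiI).
have wr t : phi (f t) = w * phi t by rewrite {1}[t]tR fR phiR.
have cw : center w by move=> r; rewrite -[r](phiK r) -wr wl.
have fw t : f t = w *: t by apply: (can_inj phi'K); rewrite wr (linZ phiI).
exists w; split=> // m; apply/eqP; rewrite -subr_eq0; apply/eqP.
set d := _ - _.
have d0 (n : N) : d *t n = 0.
  by rewrite tensDl tensNl -fE fw -scale_tens subrr.
have dpsi t : d :* psi t = 0.
  have d0r : d :* 0 = 0 by apply: (morphD0 (rscalerDr d)).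
  move: t; apply: tlift_eq => [x y|x y|n m']; rewrite ?addr0 //.
    by rewrite (linD psiI) rscalerDr.
  have bal' : balanced (fun (m : M) (n : N) => m :* (psi (n *t m') : R)).
    split=> [n1 a b|m1 a b|m1 r n1]; first by rewrite rscalerDl.
      by rewrite tensDl (linD psiI) rscalerDr.
    by rewrite -scale_tens (linZ psiI) rscalerA.
  by rewrite -(tliftE bal') d0; apply: morphD0; apply: tliftD.
have [_ _ [psi' _ psiK]] := psiI.
by have := dpsi (psi' 1); rewrite psiK rscaler1.
Qed.

Lemma DeltaP (z : R) :
  center z -> center (Delta M z) /\ forall m : M, m :* z = Delta M z *: m.
Proof. by move=> /Delta_exists /(xgetPex z). Qed.

Lemma Delta_eq (z w : R) :
  center z -> (forall m : M, m :* z = w *: m) -> Delta M z = w.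
Proof.
move=> cz mzw; apply/eqP; rewrite -subr_eq0; apply/eqP.
apply: invertible_faithful => m; rewrite scalerBl -mzw.
by have [_ ->] := DeltaP cz; rewrite subrr.
Qed.

Lemma center1 : center (1 : R).
Proof. by move=> r; rewrite mul1r mulr1. Qed.

Lemma Delta_unit (u : R) : center_units u -> center_units (Delta M u).
Proof.
move=> [cu [v cv uv]]; have [cDu Du] := DeltaP cu; have [cDv Dv] := DeltaP cv.
split=> //; exists (Delta M v) => //.
have <- : Delta M 1 = 1.
  by apply: Delta_eq => [|m]; [exact: center1 | rewrite rscaler1 scale1r].
symmetry; apply: Delta_eq => [|m]; first exact: center1.
by rewrite -uv -rscalerA Du scale_rscale Dv scalerA.
Qed.

End DeltaTheory.

(** The group U(Z(R)); like every abelian group of the library it is written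
    additively: [u + v] is the product of [u] and [v] in [R], and [0] is [1]. *)

Definition UZ (R : pzRingType) := {u : R | u \in @center_units R}.
HB.instance Definition _ (R : pzRingType) := SubChoice.on (UZ R).

Section UZgroup.
Variable R : pzRingType.
Implicit Types u v w : UZ R.

Lemma UZP u : center_units (val u). Proof. exact: set_mem (valP u). Qed.

Definition toUZ (r : R) (ur : center_units r) : UZ R := exist _ r (mem_set ur).

Fact UZ_one_subproof : center_units (1 : R).
Proof.
split; first exact: center1.
by exists 1; [exact: center1 | rewrite mulr1].
Qed.

Fact UZ_mul_subproof u v : center_units (val u * val v).
Proof.
have [cu [u' cu' uu']] := UZP u; have [cv [v' cv' vv']] := UZP v.
have cM (a b : R) : center a -> center b -> center (a * b).
  by move=> ca cb r; rewrite -mulrA cb mulrA ca mulrA.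
split; first exact: cM.
by exists (v' * u'); [exact: cM | rewrite mulrA -(mulrA (val u)) vv' mulr1].
Qed.

Definition UZ_inv_val u : R :=
  xget 1 [set r | center r /\ val u * r = 1].

Fact UZ_inv_valP u : center (UZ_inv_val u) /\ val u * UZ_inv_val u = 1.
Proof.
have [_ [v cv uv]] := UZP u.
have : exists r : R, center r /\ val u * r = 1 by exists v.
by move/(xgetPex 1).
Qed.

Fact UZ_inv_subproof u : center_units (UZ_inv_val u).
Proof.
have [ci ui] := UZ_inv_valP u; split=> //.
by have [cu _] := UZP u; exists (val u) => //; rewrite ci.
Qed.

Definition UZ_one : UZ R := toUZ UZ_one_subproof.
Definition UZ_mul u v : UZ R := toUZ (UZ_mul_subproof u v).
Definition UZ_inv u : UZ R := toUZ (UZ_inv_subproof u).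

Fact UZ_mulA : associative UZ_mul.
Proof. by move=> u v w; apply: val_inj; rewrite /= mulrA. Qed.
Fact UZ_mulC : commutative UZ_mul.
Proof. by move=> u v; apply: val_inj => /=; have [-> _] := UZP u. Qed.
Fact UZ_mul1 : left_id UZ_one UZ_mul.
Proof. by move=> u; apply: val_inj; rewrite /= mul1r. Qed.
Fact UZ_mulV : left_inverse UZ_one UZ_inv UZ_mul.
Proof.
by move=> u; rewrite UZ_mulC; apply: val_inj => /=; have [] := UZ_inv_valP u.
Qed.

HB.instance Definition _ :=
  GRing.isZmodule.Build (UZ R) UZ_mulA UZ_mulC UZ_mul1 UZ_mulV.

End UZgroup.

Definition pic_act (R : pzRingType) (C : Pic R) (u : UZ R) : UZ R :=
  toUZ (Delta_unit (pic_repP C).1 (UZP u)).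

Section Cohomology.
Variables (H : groupType) (P : {pred H}) (A : zmodType) (act : H -> A -> A).

Definition cochain n := n.-tuple H -> A.

Definition relative_cochain n (c : cochain n) : Prop :=
  (forall t : n.-tuple H, 1%g \in t -> c t = 0) /\
  (forall t : n.-tuple H, {subset t <= P} -> c t = 0).

(* The arguments (t_0, ..., t_i * t_(i+1), ..., t_n). *)
Definition inner_face n (t : n.+1.-tuple H) (i : 'I_n) : n.-tuple H :=
  [tuple if (j < i)%N then tnth t (widen_ord (leqnSn n) j)
         else if j == i then
           (tnth t (widen_ord (leqnSn n) j) * tnth t (fintype.lift ord0 j))%g
         else tnth t (fintype.lift ord0 j) | j < n].

Definition coboundary n (c : cochain n) : cochain n.+1 := fun t =>
  act (thead t) (c [tuple tnth t (fintype.lift ord0 j) | j < n])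
  + \sum_(i < n) c (inner_face t i) *~ (-1) ^+ i.+1
  + c [tuple tnth t (widen_ord (leqnSn n) j) | j < n] *~ (-1) ^+ n.+1.

(* The coset of [c] modulo relative coboundaries; when [c] is a relative
   cocycle, this is its class in H^(n+1), as an element of the quotient. *)
Definition coh_class n (c : cochain n.+1) : set (cochain n.+1) :=
  [set c' | exists2 b : cochain n, relative_cochain b &
     forall t, c' t = c t + coboundary b t].

End Cohomology.

Record is_grading (H : groupType) (A : pzRingType) (A_ : H -> set A) : Prop := {
  grading0 : forall h, A_ h 0;
  gradingB : forall h a b, A_ h a -> A_ h b -> A_ h (a - b);
  grading_span : forall a, exists s (f : H -> A),
    [/\ uniq s, forall h, A_ h (f h) & a = \sum_(h <- s) f h];
  grading_free : forall s (f : H -> A), uniq s -> (forall h, A_ h (f h)) ->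
    \sum_(h <- s) f h = 0 -> forall h, h \in s -> f h = 0;
  gradingM : forall h k a b, A_ h a -> A_ k b -> A_ (h * k)%g (a * b)
}.

(* The additive subgroup generated by the products, for additive subgroups
   X and Y. *)
Definition prod_set (A : pzRingType) (X Y : set A) : set A :=
  [set c | exists n (a b : 'I_n -> A),
     [/\ forall i, X (a i), forall i, Y (b i) & c = \sum_(i < n) a i * b i]].

Record stronglyGraded (H : groupType) := StronglyGraded {
  sg_ring :> pzRingType;
  homog : H -> set sg_ring;
  homogP : is_grading homog;
  homog_strong : forall h k, prod_set (homog h) (homog k) = homog (h * k)%g
}.
Arguments homog {H} s h.
Arguments homogP {H} s.

Section Component.
Variables (H : groupType) (A : stronglyGraded H).

Definition homog_pred (h : H) : {pred A} := fun a => a \in homog A h.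

Fact homog_zmod h : zmod_closed (homog_pred h).
Proof.
have [A0 AB _ _ _] := homogP A; split=> [|a b]; first exact: mem_set (A0 h).
by move=> /set_mem Aa /set_mem Ab; apply: mem_set; apply: AB.
Qed.

HB.instance Definition _ h := GRing.isZmodClosed.Build A (homog_pred h) (homog_zmod h).

Definition component (h : H) := {a : A | a \in homog_pred h}.
HB.instance Definition _ h := SubChoice.on (component h).
HB.instance Definition _ h := [SubChoice_isSubZmodule of component h by <:].

Lemma componentP h (a : component h) : homog A h (val a).
Proof. exact: set_mem (valP a). Qed.

Definition to_component h (a : A) (ha : homog A h a) : component h :=
  exist _ a (mem_set ha).

Lemma homog1 : homog A 1%g 1.
Proof.
have [gr0 grB grS grF grM] := homogP A.
have [s [f [us Af s1]]] := grS 1.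
pose s' := 1%g :: [seq h <- s | h != 1%g].
pose f' h := if h \in s then f h else 0.
have us' : uniq s' by rewrite /= mem_filter eqxx filter_uniq.
have Af' h : homog A h (f' h) by rewrite /f'; case: ifP.
have s1' : 1 = \sum_(h <- s') f' h.
  have fE : \sum_(h <- s | h != 1%g) f' h = \sum_(h <- s | h != 1%g) f h.
    rewrite big_seq_cond [RHS]big_seq_cond.
    by apply: eq_bigr => h /andP[hs _]; rewrite /f' hs.
  rewrite big_cons big_filter fE {1}/f'.
  case: (boolP (1%g \in s)) => s1g; first by rewrite s1 (bigD1_seq 1%g).
  rewrite add0r s1 big_seq [RHS]big_seq_cond; apply: eq_bigl => h.
  by case: eqP => [->|_]; rewrite ?andbT ?(negPf s1g).
suff hom k (a : A) : homog A k a -> a * f' 1%g = a.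
  have e1 : 1 * f' 1%g = 1.
    rewrite {1}s1' mulr_suml [RHS]s1'; apply: eq_bigr => h _; exact: hom (Af' h).
  by rewrite -e1 mul1r.
move=> Aa; apply/eqP; rewrite -subr_eq0; apply/eqP.
pose g x := a * f' (k^-1 * x)%g - (if x == k then a else 0).
have := grF [seq (k * h)%g | h <- s'] g; rewrite map_inj_uniq; last exact: mulgI.
move=> /(_ us') /(_ _ _ k); rewrite /g eqxx mulVg; apply.
- move=> x; apply: grB; last by case: eqP => [->|].
  by have := grM _ _ _ _ Aa (Af' (k^-1 * x)%g); rewrite mulVKg.
- rewrite big_map sumrB; under eq_bigr do rewrite mulKg.
  rewrite -mulr_sumr -s1' mulr1 (bigD1_seq 1%g) ?mem_head //= mulg1 eqxx.
  rewrite big1 ?addr0 ?subrr // => h h1; case: eqP => // kh.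
  by case/eqP: h1; apply: (mulgI k); rewrite kh mulg1.
- by apply/mapP; exists 1%g; rewrite ?mem_head ?mulg1.
Qed.

Definition principal := component 1%g.
HB.instance Definition _ := GRing.SubZmodule.on principal.

Fact principal_subring : subring_closed (homog_pred 1%g).
Proof.
have [_ AB _ _ AM] := homogP A.
split=> [|a b|a b]; first exact: mem_set homog1.
  by move=> /set_mem Aa /set_mem Ab; apply: mem_set; apply: AB.
move=> /set_mem Aa /set_mem Ab; apply: mem_set.
by have := AM _ _ _ _ Aa Ab; rewrite mulg1.
Qed.

HB.instance Definition _ :=
  GRing.SubZmodule_isSubPzRing.Build A (homog_pred 1%g) principal
    principal_subring.

Lemma homog_mul_subproof h k (a : component h) (b : component k) :
  homog A (h * k)%g (val a * val b).
Proof. by have [_ _ _ _ AM] := homogP A; apply: AM; apply: componentP. Qed.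

Definition homog_mul h k (a : component h) (b : component k) :
    component (h * k)%g :=
  to_component (homog_mul_subproof a b).

End Component.

(* The component [A_h] as a bimodule over a ring [R] that is mapped to [A] by
   a ring morphism [j] with values in the principal component. *)
Definition component_along (H : groupType) (A : stronglyGraded H)
  (R : pzRingType) (j : {rmorphism R -> A}) of (forall r, homog A 1%g (j r)) :=
  @component H A.

Section ComponentBimodule.
Variables (H : groupType) (A : stronglyGraded H) (R : pzRingType).
Variables (j : {rmorphism R -> A}) (Aj : forall r, homog A 1%g (j r)) (h : H).
Local Notation M := (component_along Aj h).

HB.instance Definition _ := GRing.SubZmodule.on M.

Fact component_scale_subproof (r : R) (a : M) : homog A h (j r * val a).
Proof.
have [_ _ _ _ AM] := homogP A.
by have := AM _ _ _ _ (Aj r) (componentP a); rewrite mul1g.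
Qed.

Fact component_rscale_subproof (a : M) (r : R) : homog A h (val a * j r).
Proof.
have [_ _ _ _ AM] := homogP A.
by have := AM _ _ _ _ (componentP a) (Aj r); rewrite mulg1.
Qed.

Definition component_scale (r : R) (a : M) : M :=
  to_component (component_scale_subproof r a).
Definition component_rscale (a : M) (r : R) : M :=
  to_component (component_rscale_subproof a r).

Fact component_scaleA a b v :
  component_scale a (component_scale b v) = component_scale (a * b) v.
Proof. by apply: val_inj; rewrite /= rmorphM mulrA. Qed.
Fact component_scale1 : left_id 1 component_scale.
Proof. by move=> v; apply: val_inj; rewrite /= rmorph1 mul1r. Qed.
Fact component_scaleDr : right_distributive component_scale +%R.
Proof. by move=> a u v; apply: val_inj; rewrite /= mulrDr. Qed.
Fact component_scaleDl v : {morph component_scale^~ v : a b / a + b}.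
Proof. by move=> a b; apply: val_inj; rewrite /= rmorphD mulrDl. Qed.

HB.instance Definition _ := GRing.Zmodule_isLmodule.Build R M
  component_scaleA component_scale1 component_scaleDr component_scaleDl.

Fact component_rscaleA v a b :
  component_rscale (component_rscale v a) b = component_rscale v (a * b).
Proof. by apply: val_inj; rewrite /= rmorphM mulrA. Qed.
Fact component_rscale1 v : component_rscale v 1 = v.
Proof. by apply: val_inj; rewrite /= rmorph1 mulr1. Qed.
Fact component_rscaleDl a : {morph component_rscale^~ a : u v / u + v}.
Proof. by move=> u v; apply: val_inj; rewrite /= mulrDl. Qed.
Fact component_rscaleDr v : {morph component_rscale v : a b / a + b}.
Proof. by move=> a b; apply: val_inj; rewrite /= rmorphD mulrDr. Qed.
Fact component_scale_rscale a v b :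
  component_rscale (a *: v) b = a *: component_rscale v b.
Proof. by apply: val_inj; rewrite /= mulrA. Qed.

HB.instance Definition _ := Lmodule_isBimodule.Build R M
  component_rscaleA component_rscale1 component_rscaleDl component_rscaleDr
  component_scale_rscale.

End ComponentBimodule.

Section PrincipalBimodule.
Variables (H : groupType) (A : stronglyGraded H).

Definition principal_val : principal A -> A := val.
HB.instance Definition _ := GRing.RMorphism.on principal_val.

Lemma principal_valP (r : principal A) : homog A 1%g (principal_val r).
Proof. exact: componentP. Qed.

Definition comp_bimod (h : H) : bimodType (principal A) :=
  component_along principal_valP h.

End PrincipalBimodule.

Section Lift.
Variables (Gh : groupType) (P : {pred Gh}) (G : subGroupType P).
Variable S : stronglyGraded G.

(* The inclusion of [S] in its lift is rendered by the embedding [lift_emb]. *)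
Record graded_lift := GradedLift {
  lift_ring :> stronglyGraded Gh;
  lift_emb : {rmorphism S -> lift_ring};
  lift_inj : injective lift_emb;
  lift_homog : forall g : G, homog lift_ring (val g) = lift_emb @` homog S g
}.

Variable L : graded_lift.

Definition lift_base : principal S -> L := lift_emb L \o @principal_val G S.
HB.instance Definition _ := GRing.RMorphism.on lift_base.

Lemma lift_baseP (r : principal S) : homog L 1%g (lift_base r).
Proof.
by rewrite -(val1 G) lift_homog; exists (val r); first exact: componentP.
Qed.

(* [L_x] as a bimodule over [R = S_e], which [lift_emb] identifies with [L_e]. *)
Definition lift_bimod (x : Gh) : bimodType (principal S) :=
  component_along lift_baseP x.

End Lift.

Definition transport (T : Type) (M : T -> Type) (x y : T) (e : x = y)
    (m : M x) : M y :=
  ecast z (M z) e m.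

Section CharacteristicClass.
Variables (Gh : groupType) (P : {pred Gh}) (G : subGroupType P).
Variables (S : stronglyGraded G) (ph : Gh -> Pic (principal S)).
Local Notation R := (principal S).

(* The choices of M_x and mu_{x,y}.  M_g = S_g is an identification through
   given isomorphisms [fs_emb g], along which the data can be transported to
   have M_g equal to S_g, with the same associator; [transport] only absorbs
   the group laws in the indices. *)
Record factor_system := FactorSystem {
  fs_mod :> Gh -> bimodType R;
  fs_mod_class : forall x, pic_class (ph x) (fs_mod x);
  fs_emb : forall g : G, comp_bimod S g -> fs_mod (val g);
  fs_emb_iso : forall g, is_bimod_iso (@fs_emb g);
  fs_mu : forall x y, tensor (fs_mod x) (fs_mod y) -> fs_mod (x * y)%g;
  fs_mu_iso : forall x y, is_bimod_iso (@fs_mu x y);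
  fs_mu_emb : forall (g h : G) (s : comp_bimod S g) (t : comp_bimod S h),
    fs_mu (fs_emb s *t fs_emb t) =
    transport (M := fs_mod) (valM g h) (fs_emb (homog_mul s t));
  fs_mu1x : forall x (r : R) (m : fs_mod x),
    fs_mu (transport (M := fs_mod) (val1 G) (fs_emb (r : comp_bimod S 1%g))
           *t m) =
    transport (M := fs_mod) (esym (mul1g x)) (r *: m);
  fs_mux1 : forall x (m : fs_mod x) (r : R),
    fs_mu (m *t transport (M := fs_mod) (val1 G)
                  (fs_emb (r : comp_bimod S 1%g))) =
    transport (M := fs_mod) (esym (mulg1 x)) (m :* r)
}.

(* mu_{xy,z} o (mu_{x,y} (x) id) = alpha(x,y,z) mu_{x,yz} o (id (x) mu_{y,z}),
   evaluated on the pure tensors, which generate M_x (x) M_y (x) M_z. *)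
Definition is_associator (F : factor_system) (alpha : cochain Gh (UZ R) 3) :=
  forall x y z (m : F x) (n : F y) (l : F z),
    fs_mu (fs_mu (m *t n) *t l) =
    transport (M := fs_mod F) (mulgA x y z)
      (val (alpha [tuple x; y; z]) *: fs_mu (m *t fs_mu (n *t l))).

Definition hat_act (x : Gh) (u : UZ R) : UZ R := pic_act (ph x) u.

(* An element of H^3 is a coset of relative coboundaries.  All the choices give
   the same coset, so that the union below, over all choices, is the class of
   any one of them; it requires no selection of a particular choice. *)
Definition char_class : set (cochain Gh (UZ R) 3) :=
  [set c | exists (F : factor_system) (alpha : cochain Gh (UZ R) 3),
     is_associator F alpha /\ coh_class P hat_act alpha c].

Definition zero_class : set (cochain Gh (UZ R) 3) :=
  coh_class P hat_act (fun=> 0).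

End CharacteristicClass.

(* Main.v *)
Require Import Defs.
From mathcomp Require Import all_boot all_algebra.
From HB Require Import structures.
From mathcomp Require Import boolp classical_sets.

(** A factor system consists of modules M_x with products
    M_x (x) M_y -> M_{xy}, and the associator measures how far these products
    are from being associative.  A lift is the same thing as a factor system
    with trivial associator.

    From a lift L, the components L_x with the multiplication of L form a factor
    system with associator 1 ([lift_factor_system], [lift_associator]).  The
    multiplication L_x (x) L_y -> L_{xy} is bijective because strong
    gradedness gives 1 = sum_i a_i b_i with a_i in L_{y^-1} and b_i in L_y,
    so that c |-> sum_i c a_i (x) b_i is its inverse.  Now let F be any
    factor system.  Its modules can be identified with the components of L
    compatibly with S ([realization_exists]); the product of L on
    M_x (x) M_y then differs from that of F by a central unit u(x,y)
    ([comparison_unit], [rl_comparison]).  These units form a relative 2-cochain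
    whose coboundary is the associator of F ([rl_associator]): compute a product
    of three homogeneous elements of L in the two possible ways, moving a
    central unit past an element of degree x by the action of x.  Hence every
    associator is a relative coboundary, and the characteristic class is the
    zero class.

    Conversely, if the class is trivial, some factor system has an associator
    which is a coboundary -d b.  Multiplying its products by -b (in additive
    notation) gives a factor system with trivial associator ([twist],
    [twist_associator]).  Its direct sum is then an associative ring, strongly
    graded because the products are surjective.  The isomorphisms of S_g with
    M_g embed S into it, multiplicatively by the compatibility of the
    products with that of S ([crossed_lift]). *)

Set Implicit Arguments.
Unset Strict Implicit.
Unset Printing Implicit Defensive.

Import GRing.Theory.

Local Open Scope classical_set_scope.
Local Open Scope ring_scope.

(** * Additive maps and direct sums of abelian groups *)

Section AdditiveMaps.
Variables (U V : zmodType) (f : U -> V) (fD : {morph f : x y / x + y}).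

Lemma morphD_sum (I : Type) (s : seq I) (F : I -> U) :
  f (\sum_(i <- s) F i) = \sum_(i <- s) f (F i).
Proof. exact: (big_morph f fD (morphD0 fD)). Qed.

Lemma morphDN x : f (- x) = - f x.
Proof. by apply: (addrI (f x)); rewrite -fD !subrr; apply: morphD0. Qed.

Lemma morphDB x y : f (x - y) = f x - f y.
Proof. by rewrite fD morphDN. Qed.

Lemma morphD_inj : (forall x, f x = 0 -> x = 0) -> injective f.
Proof.
move=> f0 x y fxy; apply/eqP; rewrite -subr_eq0; apply/eqP/f0.
by rewrite morphDB fxy subrr.
Qed.

End AdditiveMaps.

Lemma inj_surj_bij (U V : Type) (f : U -> V) :
  injective f -> (forall v, exists u, f u = v) -> bijective f.
Proof.
move=> f_inj /choice[g fg]; exists g => // u; exact/f_inj/fg.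
Qed.

Lemma dep_choice (I : Type) (T : I -> Type) (Q : forall i, T i -> Prop) :
  (forall i, exists t, Q i t) -> exists f : forall i, T i, forall i, Q i (f i).
Proof. by move=> QT; exists (fun i => projT1 (cid (QT i))) => i; case: cid. Qed.

Section DirectSum.
Variables (I : choiceType) (M : I -> zmodType).

(** Finitely supported families, so that coordinates can be read off by
    evaluation. *)
Record dsum := DSum {
  dcoord : forall i, M i;
  dsum_finite : exists s : seq I, forall i, i \notin s -> dcoord i = 0
}.

Lemma dsum_ext (f g : dsum) : (forall i, dcoord f i = dcoord g i) -> f = g.
Proof.
case: f g => [f ff] [g gf] /= fg; have e : f = g by apply: functional_extensionality_dep.
by rewrite -e in gf *; congr DSum; apply: Prop_irrelevance.
Qed.

HB.instance Definition _ := gen_eqMixin dsum.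
HB.instance Definition _ := gen_choiceMixin dsum.

Fact dsum_zero_finite :
  exists s : seq I, forall i, i \notin s -> (0 : M i) = 0.
Proof. by exists [::]. Qed.

Fact dsum_opp_finite (f : dsum) :
  exists s : seq I, forall i, i \notin s -> - dcoord f i = 0.
Proof. by have [s fs] := dsum_finite f; exists s => i /fs ->; rewrite oppr0. Qed.

Fact dsum_add_finite (f g : dsum) :
  exists s : seq I, forall i, i \notin s -> dcoord f i + dcoord g i = 0.
Proof.
have [s fs] := dsum_finite f; have [t gt] := dsum_finite g.
exists (s ++ t) => i; rewrite mem_cat negb_or => /andP[/fs -> /gt ->].
exact: addr0.
Qed.

Definition dsum_zero := DSum dsum_zero_finite.
Definition dsum_opp f := DSum (dsum_opp_finite f).
Definition dsum_add f g := DSum (dsum_add_finite f g).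

Fact dsum_addA : associative dsum_add.
Proof. by move=> f g h; apply: dsum_ext => i; apply: addrA. Qed.
Fact dsum_addC : commutative dsum_add.
Proof. by move=> f g; apply: dsum_ext => i; apply: addrC. Qed.
Fact dsum_add0 : left_id dsum_zero dsum_add.
Proof. by move=> f; apply: dsum_ext => i; apply: add0r. Qed.
Fact dsum_addN : left_inverse dsum_zero dsum_opp dsum_add.
Proof. by move=> f; apply: dsum_ext => i; apply: addNr. Qed.

HB.instance Definition _ :=
  GRing.isZmodule.Build dsum dsum_addA dsum_addC dsum_add0 dsum_addN.

Lemma dcoordD i : {morph (fun f : dsum => dcoord f i) : f g / f + g}.
Proof. by []. Qed.

Lemma dinj_finite i (m : M i) : exists s : seq I, forall k, k \notin s ->
  (if i =P k is ReflectT e then transport (M := M) e m else 0) = 0.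
Proof.
exists [:: i] => k; rewrite inE => ki; case: eqP => // e.
by case/eqP: ki.
Qed.

Definition dinj i (m : M i) : dsum := DSum (dinj_finite m).

Lemma dcoord_dinj i (m : M i) : dcoord (dinj m) i = m.
Proof. by rewrite /=; case: eqP => // e; rewrite (eq_irrelevance e (erefl i)). Qed.

Lemma dcoord_dinj0 i (m : M i) k : i != k -> dcoord (dinj m) k = 0.
Proof. by rewrite /=; case: eqP. Qed.

(** Casts along equalities of indices disappear in the direct sum; this is what
    turns the identities of factor systems into identities of rings. *)
Lemma dinj_transport i k (e : i = k) (m : M i) :
  dinj (transport (M := M) e m) = dinj m.
Proof. by case: k / e. Qed.

Lemma dinjD i : {morph @dinj i : m n / m + n}.
Proof.
move=> m n; apply: dsum_ext => k; rewrite dcoordD.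
have [<-|ik] := eqVneq i k; first by rewrite !dcoord_dinj.
by rewrite !dcoord_dinj0 ?addr0.
Qed.

Lemma dinj_inj i : injective (@dinj i).
Proof. by move=> m n mn; rewrite -(dcoord_dinj m) mn dcoord_dinj. Qed.

Definition dsupp (f : dsum) : seq I := undup (projT1 (cid (dsum_finite f))).

Lemma dsuppP (f : dsum) i : i \notin dsupp f -> dcoord f i = 0.
Proof. by rewrite mem_undup; apply: (projT2 (cid (dsum_finite f))). Qed.

Section Lift.
Variables (V : zmodType) (phi : forall i, M i -> V).

(** The universal property of the direct sum: additive maps on the summands
    extend uniquely ([dlift_dinj], [dsum_eq]). *)
Definition dlift (f : dsum) : V := \sum_(i <- dsupp f) phi (dcoord f i).

Hypothesis phiD : forall i, {morph @phi i : m n / m + n}.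

Let dlift_supp (f : dsum) (s : seq I) :
  uniq s -> (forall i, i \notin s -> dcoord f i = 0) ->
  dlift f = \sum_(i <- s) phi (dcoord f i).
Proof.
move=> us fs; rewrite /dlift.
have rm0 (r : seq I) : \sum_(i <- r) phi (dcoord f i) =
    \sum_(i <- [seq i <- r | dcoord f i != 0]) phi (dcoord f i).
  rewrite big_filter [RHS]big_mkcond; apply: eq_bigr => i _.
  by case: eqP => // ->; apply: morphD0.
rewrite rm0 [RHS]rm0; apply/perm_big/uniq_perm; rewrite ?filter_uniq ?undup_uniq //.
move=> i; rewrite !mem_filter; case: eqP => //= fi; apply/idP/idP => _.
  by apply: contra_notT fi => /fs.
by apply: contra_notT fi => /dsuppP.
Qed.

Lemma dliftD : {morph dlift : f g / f + g}.
Proof.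
move=> f g; pose s := undup (dsupp f ++ dsupp g).
have us : uniq s by apply: undup_uniq.
have sP i : i \notin s -> dcoord f i = 0 /\ dcoord g i = 0.
  by rewrite mem_undup mem_cat negb_or => /andP[/dsuppP-> /dsuppP->].
rewrite !(dlift_supp us) => [|i /sP[]|i /sP[]|i /sP[]] //.
  by rewrite -big_split /=; apply: eq_bigr => i _; apply: phiD.
by rewrite dcoordD => -> ->; rewrite addr0.
Qed.

Lemma dlift_dinj i (m : M i) : dlift (dinj m) = phi m.
Proof.
rewrite (@dlift_supp _ [:: i]) ?big_seq1 ?dcoord_dinj // => k.
by rewrite inE eq_sym => /dcoord_dinj0.
Qed.

End Lift.

Lemma dsum_expand (f : dsum) : f = \sum_(i <- dsupp f) dinj (dcoord f i).
Proof.
apply: dsum_ext => k; rewrite (morphD_sum (@dcoordD k)).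
have [kf|kf] := boolP (k \in dsupp f); last first.
  rewrite dsuppP // big1_seq // => i /andP[_ i_f]; apply: dcoord_dinj0.
  by apply: contraNneq kf => <-.
rewrite (bigD1_seq k) ?undup_uniq // dcoord_dinj.
rewrite big1 => [|i ik]; first by rewrite [RHS]addr0.
exact: dcoord_dinj0.
Qed.

Lemma dsum_ind (Q : dsum -> Prop) :
  Q 0 -> (forall f g, Q f -> Q g -> Q (f + g)) ->
  (forall i (m : M i), Q (dinj m)) -> forall f, Q f.
Proof. by move=> Q0 QD Qi f; rewrite (dsum_expand f); apply: big_ind. Qed.

Lemma dsum_eq (V : zmodType) (f g : dsum -> V) :
  {morph f : x y / x + y} -> {morph g : x y / x + y} ->
  (forall i (m : M i), f (dinj m) = g (dinj m)) -> f =1 g.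
Proof.
move=> fD gD fg; apply: dsum_ind => [|x y fx fy|//].
  by rewrite !morphD0.
by rewrite fD gD fx fy.
Qed.

Lemma dliftDl (V : zmodType) (phi psi : forall i, M i -> V) f :
  dlift (fun i m => phi i m + psi i m) f = dlift phi f + dlift psi f.
Proof. exact: big_split. Qed.

End DirectSum.

(** * Strongly graded rings *)

Section Grading.
Variables (H : groupType) (A : stronglyGraded H).
Local Notation A_ := (homog A).

Lemma homog_0 h : A_ h 0.
Proof. by have [] := homogP A. Qed.

Lemma homog_B h a b : A_ h a -> A_ h b -> A_ h (a - b).
Proof. by have [_ + _ _ _] := homogP A; apply. Qed.

Lemma homog_D h a b : A_ h a -> A_ h b -> A_ h (a + b).
Proof.
by move=> Aa Ab; rewrite -[b]opprK -[- b]sub0r; do 2?apply: homog_B => //; apply: homog_0.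
Qed.

Lemma homog_M h k a b : A_ h a -> A_ k b -> A_ (h * k)%g (a * b).
Proof. by have [_ _ _ _] := homogP A; apply. Qed.

Lemma homog_sum h (I : Type) (s : seq I) (F : I -> A) :
  (forall i, A_ h (F i)) -> A_ h (\sum_(i <- s) F i).
Proof. by move=> AF; apply: big_ind => //; [apply: homog_0 | apply: homog_D]. Qed.

(** The finite form in which strong gradedness is used: a product of the
    components of degrees [h] and [h^-1] reaches [1]. *)
Lemma homog_unit_sum h : exists n (a b : 'I_n -> A),
  [/\ forall i, A_ h (a i), forall i, A_ h^-1%g (b i) & 1 = \sum_(i < n) a i * b i].
Proof.
suff: prod_set (A_ h) (A_ h^-1%g) 1 by case=> n [a [b]]; exists n, a, b.
by rewrite homog_strong mulgV; apply: homog1.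
Qed.

Lemma homog_faithful h w : (forall a, A_ h a -> w * a = 0) -> w = 0.
Proof.
move=> wA; have [n [a [b [Aa _ ab1]]]] := homog_unit_sum h.
rewrite -[w]mulr1 ab1 mulr_sumr big1 // => i _.
by rewrite mulrA wA ?mul0r.
Qed.

(** The grading as an identification of [A] with the external direct sum of its
    components; maps out of [A] are then built componentwise. *)
Definition gr_sum : dsum (@component H A) -> A := dlift (fun h a => val a).

Lemma gr_sumD : {morph gr_sum : f g / f + g}.
Proof. exact: dliftD. Qed.

Lemma gr_sum_dinj h (a : component A h) : gr_sum (dinj a) = val a.
Proof. exact: dlift_dinj. Qed.

Lemma gr_sum_bij : bijective gr_sum.
Proof.
have [_ _ grS grF _] := homogP A.
apply: inj_surj_bij => [|a].
  apply: (morphD_inj gr_sumD) => f f0; apply: dsum_ext => h.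
  have [hf|/dsuppP-> //] := boolP (h \in dsupp f).
  apply: val_inj; apply: (grF (dsupp f) (fun h => val (dcoord f h))) => //.
    exact: undup_uniq.
  by move=> k; apply: componentP.
have [s [f [us Af ->]]] := grS a.
exists (\sum_(h <- s) dinj (to_component (Af h))).
rewrite (morphD_sum gr_sumD); apply: eq_bigr => h _.
by rewrite gr_sum_dinj.
Qed.

Lemma homog_ind (Q : A -> Prop) :
  Q 0 -> (forall a b, Q a -> Q b -> Q (a + b)) ->
  (forall h (a : component A h), Q (val a)) -> forall a, Q a.
Proof.
move=> Q0 QD Qh a; have [s _ sK] := gr_sum_bij; rewrite -(sK a).
move: (s a); apply: dsum_ind => [|f g|h b].
- by rewrite (morphD0 gr_sumD).
- by rewrite gr_sumD; apply: QD.
- by rewrite gr_sum_dinj.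
Qed.

End Grading.

Lemma prod_set_0 (A : pzRingType) (X Y : set A) : prod_set X Y 0.
Proof.
exists 0%N, (fun=> 0), (fun=> 0); rewrite big_ord0.
by split=> // -[].
Qed.

Lemma prod_set_D (A : pzRingType) (X Y : set A) a b :
  prod_set X Y a -> prod_set X Y b -> prod_set X Y (a + b).
Proof.
case=> n [a1 [b1 [Xa Yb ->]]] [m [a2 [b2 [Xa' Yb' ->]]]].
exists (n + m)%N, (fun i => match split i with inl j => a1 j | inr j => a2 j end),
  (fun i => match split i with inl j => b1 j | inr j => b2 j end).
split=> [i|i|]; [by case: split | by case: split |].
rewrite big_split_ord /=; congr (_ + _); apply: eq_bigr => i _.
  by rewrite (unsplitK (inl i)).
by rewrite (unsplitK (inr i)).
Qed.

(** * Bimodules and their classes *)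

Section Bimodules.
Variable R : pzRingType.
Implicit Types (M N L : bimodType R).

Lemma bimod_iso_refl M : bimod_iso M M.
Proof. by exists id; split=> //; exists id. Qed.

Lemma bimod_iso_sym M N : bimod_iso M N -> bimod_iso N M.
Proof.
case=> f fI; have [_ fR [g fK gK]] := fI; exists g; split; last by exists f.
  move=> r x y; apply: (can_inj fK).
  by rewrite (linD fI) (linZ fI) !gK.
by move=> m r; apply: (can_inj fK); rewrite fR !gK.
Qed.

Lemma bimod_iso_trans M N L : bimod_iso M N -> bimod_iso N L -> bimod_iso M L.
Proof.
case=> f fI [g gI]; exists (g \o f).
have [_ fR fB] := fI; have [_ gR gB] := gI; split; last exact: bij_comp.
  by move=> r x y /=; rewrite (linD fI) (linZ fI) (linD gI) (linZ gI).
by move=> m r /=; rewrite fR gR.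
Qed.

Lemma iso_class_eq M N : bimod_iso M N -> iso_class M = iso_class N.
Proof.
move=> MN; apply: funext => L; apply/propext; split.
  by apply: bimod_iso_trans; apply: bimod_iso_sym.
exact: bimod_iso_trans.
Qed.

Lemma pic_classE (C : Pic R) M : pic_class C M -> pic_class C = iso_class M.
Proof.
by have [_ ->] := pic_repP C; apply: iso_class_eq.
Qed.

Lemma pic_class_iso (C : Pic R) M N :
  pic_class C M -> pic_class C N -> bimod_iso M N.
Proof. by move/pic_classE=> ->. Qed.

(** Invertible bimodules are faithful, and faithfulness is invariant under
    isomorphism, so a central element can be read off any representative. *)
Lemma pic_class_faithful (C : Pic R) M (z : R) :
  pic_class C M -> (forall m : M, z *: m = 0) -> z = 0.
Proof.
have [invC ->] := pic_repP C => -[f fI] zM; apply: (invertible_faithful invC) => m.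
have [_ _ [g fK _]] := fI; apply: (can_inj fK).
by rewrite (linZ fI) zM (morphD0 (linD fI)).
Qed.

(** The defining property of the action holds on every representative of the
    class, not only on the chosen one. *)
Lemma pic_actP (C : Pic R) M (u : UZ R) :
  pic_class C M -> forall m : M, m :* val u = val (pic_act C u) *: m.
Proof.
have [invC ->] := pic_repP C => -[f fI] m.
have [_ fR [g fK gK]] := fI; rewrite -(gK m) -fR -(linZ fI); congr f.
by have [cu _] := UZP u; have [_] := DeltaP invC cu; apply.
Qed.

Lemma transport_scale (T : Type) (M : T -> bimodType R) x y (e : x = y) r (m : M x) :
  r *: transport (M := M) e m = transport (M := M) e (r *: m).
Proof. by case: y / e. Qed.

(** As u is central, v u = u v = 1, and v r = v r (u v) = (v u) r v = r v. *)
Lemma center_units_inv (u v : R) :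
  center u -> u * v = 1 -> center_units u.
Proof.
move=> cu uv; split=> //; exists v => // r.
have vu : v * u = 1 by rewrite -cu.
by rewrite -[in LHS](mulr1 r) -{1}uv (mulrA r) -cu !mulrA vu mul1r.
Qed.

Lemma UZ_valD (u v : UZ R) : val (u + v) = val u * val v.
Proof. by []. Qed.

Lemma UZ_scaleK M (u : UZ R) (m : M) : val u *: (val (- u) *: m) = m.
Proof.
rewrite scalerA (_ : val u * val (- u) = val (u - u)) // subrr; exact: scale1r.
Qed.

Lemma UZ_scale_iso M N (u : UZ R) (f : M -> N) :
  is_bimod_iso f -> is_bimod_iso (fun m => val u *: f m).
Proof.
move=> fI; have [_ fR [g fK gK]] := fI; split=> [r m n|m r|].
- by rewrite (linD fI) (linZ fI) scalerDr !scalerA; have [-> _] := UZP u.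
- by rewrite fR scale_rscale.
exists (fun n => g (val (- u) *: n)) => [m|n].
  by rewrite -{2}[u]opprK UZ_scaleK fK.
by rewrite gK UZ_scaleK.
Qed.

Lemma pic_actD (C : Pic R) : {morph pic_act C : u v / u + v}.
Proof.
move=> u v; have [_ Crep] := pic_repP C.
have CM : pic_class C (pic_rep C) by rewrite Crep; apply: bimod_iso_refl.
apply: val_inj; apply/eqP; rewrite -subr_eq0; apply/eqP.
apply: (pic_class_faithful CM) => m; rewrite scalerBl -(pic_actP _ CM) /=.
by rewrite -rscalerA !(pic_actP _ CM) scalerA (UZP _).1 subrr.
Qed.

End Bimodules.

(** * Scalars in a lift *)

Section LiftTheory.
Variables (Gh : groupType) (P : {pred Gh}) (G : subGroupType P).
Variables (S : stronglyGraded G) (L : graded_lift S).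
Local Notation R := (principal S).
Local Notation j := (lift_base L).

Lemma lift_base_inj : injective j.
Proof. by move=> r s /(@Defs.lift_inj _ _ _ _ L) /val_inj. Qed.

Lemma lift_baseM r s : j (r * s) = j r * j s. Proof. exact: rmorphM. Qed.
Lemma lift_base1 : j 1 = 1. Proof. exact: rmorph1. Qed.
Lemma lift_base0UZ : j (val (0 : UZ R)) = 1. Proof. exact: lift_base1. Qed.
Lemma lift_baseUZD (u v : UZ R) : j (val (u + v)) = j (val u) * j (val v).
Proof. exact: lift_baseM. Qed.

Lemma lift_base_surj a : homog L 1%g a -> exists r, j r = a.
Proof.
rewrite -(val1 G) lift_homog => -[s Ss <-]; exists (to_component Ss : principal S).
by [].
Qed.

Section Comparison.
Variables (T : bimodType R) (z : Gh) (phi psi : T -> L).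
Hypotheses (phiD : {morph phi : s t / s + t}) (psiD : {morph psi : s t / s + t}).
Hypotheses (phiZ : forall r t, phi (r *: t) = j r * phi t)
  (psiZ : forall r t, psi (r *: t) = j r * psi t).
Hypotheses (phiR : forall t r, phi (t :* r) = phi t * j r)
  (psiR : forall t r, psi (t :* r) = psi t * j r).
Hypotheses (phi_inj : injective phi)
  (phi_surj : forall a, homog L z a -> exists t, phi t = a).
Hypotheses (phi_homog : forall t, homog L z (phi t))
  (psi_homog : forall t, homog L z (psi t))
  (psi_surj : forall a, homog L z a -> exists t, psi t = a).

(** With 1 = sum_i a_i b_i and phi s_i = a_i, the
    unit is u = sum_i psi(s_i) b_i, because b_i phi(m) lies in the base ring
    and can be moved inside [psi].  It is central because [phi] and [psi] are
    left linear, and surjectivity of [psi] gives the right inverse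
    sum_i phi(t_i) b_i, where psi t_i = a_i. *)
Lemma comparison_unit : exists u : UZ R, forall t, psi t = j (val u) * phi t.
Proof.
have [n [a [b [La Lb ab1]]]] := homog_unit_sum L z.
have /choice[s sa] : forall i, exists t, phi t = a i by move=> i; apply: phi_surj.
have /choice[t ta] : forall i, exists t, psi t = a i by move=> i; apply: psi_surj.
have L1 (m : L) i : homog L z m -> homog L 1%g (m * b i).
  by move=> Lm; rewrite -(mulgV z); apply: homog_M.
have [u ju] : exists u, j u = \sum_i psi (s i) * b i.
  by apply: lift_base_surj; apply: homog_sum => i; apply: L1.
have [v jv] : exists v, j v = \sum_i phi (t i) * b i.
  by apply: lift_base_surj; apply: homog_sum => i; apply: L1.
have uE m : psi m = j u * phi m.
  have /choice[c jc] i : exists c, j c = b i * phi m.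
    by apply: lift_base_surj; rewrite -(mulVg z); apply: homog_M.
  (* phi is injective and maps the right side to sum_i a_i b_i phi(m). *)
  suff {1}-> : m = \sum_i s i :* c i.
    rewrite (morphD_sum psiD) ju mulr_suml; apply: eq_bigr => i _.
    by rewrite psiR jc mulrA.
  apply: phi_inj; rewrite (morphD_sum phiD) -[LHS]mul1r ab1 mulr_suml.
  by apply: eq_bigr => i _; rewrite phiR jc sa mulrA.
have cu : center u.
  move=> r; apply: lift_base_inj; apply/eqP; rewrite -subr_eq0; apply/eqP.
  apply: (@homog_faithful _ _ z) => _ /phi_surj[m <-].
  by rewrite mulrBl !lift_baseM -!mulrA -uE -phiZ -uE psiZ subrr.
have uv : u * v = 1.
  apply: lift_base_inj; rewrite lift_baseM lift_base1 jv ab1 mulr_sumr.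
  by apply: eq_bigr => i _; rewrite mulrA -uE ta.
by exists (toUZ (center_units_inv cu uv)).
Qed.

End Comparison.
End LiftTheory.

(** * Cochains of degree two *)

Lemma tuple2E (T : Type) (t : 2.-tuple T) : exists x y, t = [tuple x; y].
Proof.
case/tupleP: t => x t; case/tupleP: t => y t; rewrite (tuple0 t).
by exists x, y; apply: val_inj.
Qed.

Lemma tuple3E (T : Type) (t : 3.-tuple T) : exists x y z, t = [tuple x; y; z].
Proof.
case/tupleP: t => x t; have [y [z ->]] := tuple2E t.
by exists x, y, z; apply: val_inj.
Qed.

Section CochainTwo.
Variables (H : groupType) (A : zmodType) (act : H -> A -> A).
Implicit Types b c : cochain H A 2.

Lemma coboundary2E b x y z : coboundary act b [tuple x; y; z] =
  act x (b [tuple y; z]) - b [tuple (x * y)%g; z] + b [tuple x; (y * z)%g]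
  - b [tuple x; y].
Proof.
rewrite /coboundary !big_ord_recl big_ord0 addr0 addrA.
have signE k : (-1 : int) ^+ k = (if odd k then -1 else 1).
  by rewrite -signr_odd; case: odd.
rewrite !signE /= !mulrN1z !mulr1z.
congr (act x (b _) - b _ + b _ - b _); apply: eq_from_tnth => -[[|[|//]] i];
  by rewrite ?tnth_mktuple.
Qed.

Hypothesis actD : forall x, {morph act x : a b / a + b}.

Lemma coboundary2D b c t :
  coboundary act (fun s => b s + c s) t = coboundary act b t + coboundary act c t.
Proof.
have [x [y [z ->]]] := tuple3E t; rewrite !coboundary2E actD.
rewrite !opprD (addrACA (act x _)) (addrACA (act x _ - _)).
by rewrite (addrACA (act x _ - _ + _)).
Qed.

Lemma coboundary2N b t : coboundary act (fun s => - b s) t = - coboundary act b t.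
Proof.
have [x [y [z ->]]] := tuple3E t; rewrite !coboundary2E (morphDN (@actD x)).
by rewrite !opprD !opprK.
Qed.

End CochainTwo.

(** * From lifts to trivial classes *)

Section Realization.
Variables (Gh : groupType) (P : {pred Gh}) (G : subGroupType P).
Variables (S : stronglyGraded G) (ph : Gh -> Pic (principal S)).
Variables (F : factor_system ph) (L : graded_lift S).
Local Notation R := (principal S).
Local Notation j := (lift_base L).

(** An identification of the modules of [F] with the components of [L], viewed
    as maps into the ring [L]: the casts of the factor system are invisible
    there.  The products of [F] and [L] need not correspond. *)
Record realization (f : forall x, F x -> L) : Prop := Realization {
  rlD : forall x, {morph @f x : m n / m + n};
  rlZ : forall x r (m : F x), f x (r *: m) = j r * f x m;
  rlR : forall x (m : F x) r, f x (m :* r) = f x m * j r;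
  rl_homog : forall x m, homog L x (f x m);
  rl_inj : forall x, injective (@f x);
  rl_surj : forall x a, homog L x a -> exists m, f x m = a;
  rl_emb : forall g s, f (val g) (fs_emb F s) = lift_emb L (val (s : component S g))
}.

Lemma lift_emb_component_subproof (g : G) (s : comp_bimod S g) :
  homog L (val g) (lift_emb L (val s)).
Proof. by rewrite lift_homog; exists (val s) => //; apply: componentP. Qed.

Definition lift_emb_component (g : G) (s : comp_bimod S g) : lift_bimod L (val g) :=
  to_component (lift_emb_component_subproof s).

Lemma lift_emb_component_iso g : is_bimod_iso (@lift_emb_component g).
Proof.
split=> [r s t|s r|].
- by apply: val_inj; rewrite /= rmorphD rmorphM.
- by apply: val_inj; rewrite /= rmorphM.
apply: inj_surj_bij => [s t st|a]; first exact/val_inj/(@Defs.lift_inj _ _ _ _ L)/(congr1 val st).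
have := componentP a; rewrite lift_homog => -[s Ss sa].
by exists (to_component Ss); apply: val_inj.
Qed.

(** Away from the subgroup any isomorphism between two representatives of the
    class will do; on the subgroup it is forced by the embeddings of the
    components of [S]. *)
Lemma realization_exists :
  (forall x, pic_class (ph x) = iso_class (lift_bimod L x)) ->
  exists f, realization f.
Proof.
move=> phL.
have: forall x, exists f : F x -> lift_bimod L x, is_bimod_iso f /\
    forall (g : G) (e : val g = x) s,
      f (transport (M := fs_mod F) e (fs_emb F s)) =
      transport (M := lift_bimod L) e (lift_emb_component s).
  move=> x; have [Px|nPx] := boolP (x \in P).
    pose g : G := Sub x Px; have <- : val g = x by apply: SubK.
    have eI := fs_emb_iso F g; have [_ eR [e' e'K eK]] := eI.
    have lI := lift_emb_component_iso g; have [_ lR lB] := lI.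
    exists (@lift_emb_component g \o e'); split.
      split=> [r m n|m r|]; last by apply: bij_comp => //; exists (@fs_emb _ _ _ _ _ F g).
        rewrite -[m]eK -[n]eK /= -(linZ eI) -(linD eI) !e'K.
        by rewrite (linD lI) (linZ lI).
      by rewrite -[m]eK -eR /= !e'K lR.
    move=> h hg; have hg' : h = g by apply: val_inj.
    move: hg; rewrite hg' => hg s; rewrite (eq_irrelevance hg (erefl _)) /=.
    by rewrite e'K.
  have [f fI] : bimod_iso (F x) (lift_bimod L x).
    apply: (pic_class_iso (fs_mod_class F x)); rewrite phL; exact: bimod_iso_refl.
  by exists f; split=> // g e; case/negP: nPx; rewrite -e; apply: valP.
case/dep_choice => f fP.
exists (fun x m => val (f x m)); split=> [x m n|x r m|x m r|x m|x m n|x a La|g s].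
- by have [fI _] := fP x; rewrite (linD fI).
- by have [fI _] := fP x; rewrite (linZ fI).
- by have [[_ -> _] _] := fP x.
- exact: componentP.
- by have [[_ _ /bij_inj f_inj] _] := fP x; move/val_inj/f_inj.
- have [[_ _ [f' _ f'K]] _] := fP x.
  by exists (f' (to_component La)); rewrite f'K.
- by have [_ /(_ g erefl s) /= ->] := fP (val g).
Qed.

Section Theory.
Variables (f : forall x, F x -> L) (fP : realization f).

(** A realization determines the Picard homomorphism of the lift. *)
Lemma rl_class x : pic_class (ph x) = iso_class (lift_bimod L x).
Proof.
rewrite (pic_classE (fs_mod_class F x)); apply: iso_class_eq.
exists (fun m => to_component (rl_homog fP m)); split=> [r m n|m r|].
- by apply: val_inj; rewrite /= (rlD fP) (rlZ fP).
- by apply: val_inj; rewrite /= (rlR fP).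
apply: inj_surj_bij => [m n /(congr1 val) /(rl_inj fP) //|a].
by have [m fm] := rl_surj fP (componentP a); exists m; apply: val_inj.
Qed.

Lemma rl_transport x y (e : x = y) (m : F x) :
  f (transport (M := fs_mod F) e m) = f m.
Proof. by case: y / e. Qed.

Lemma rl_faithful x w : (forall m : F x, w * f m = 0) -> w = 0.
Proof.
move=> wF; apply: (@homog_faithful _ _ x) => a /(rl_surj fP)[m <-]; exact: wF.
Qed.

Lemma rl_UZ_inj x (u v : UZ R) :
  (forall m : F x, j (val u) * f m = j (val v) * f m) -> u = v.
Proof.
move=> uv; apply/val_inj/(@lift_base_inj _ _ _ _ L)/eqP; rewrite -subr_eq0.
by apply/eqP/(@rl_faithful x) => m; rewrite mulrBl uv subrr.
Qed.

(** A central unit moves past an element of degree [x] at the price of the action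
    of [x]; this is where the twisted coefficients of the coboundary come
    from. *)
Lemma rl_act x (m : F x) (u : UZ R) :
  f m * j (val u) = j (val (hat_act ph x u)) * f m.
Proof. by rewrite -(rlR fP) (pic_actP u (fs_mod_class F x)) (rlZ fP). Qed.

Let rl_mul x y : tensor (F x) (F y) -> L := tlift (fun m n => f m * f n).

Let rl_mul_bal x y : balanced (fun (m : F x) (n : F y) => f m * f n).
Proof.
split=> [n a b|m a b|m r n]; first by rewrite (rlD fP) mulrDl.
  by rewrite (rlD fP) mulrDr.
by rewrite (rlR fP) (rlZ fP) mulrA.
Qed.

Let rl_mulD x y : {morph @rl_mul x y : s t / s + t}.
Proof. exact: tliftD (@rl_mul_bal x y). Qed.

Let rl_mulE x y (m : F x) (n : F y) : rl_mul (m *t n) = f m * f n.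
Proof. exact: tliftE (@rl_mul_bal x y) m n. Qed.

Let rl_mulZ x y r (t : tensor (F x) (F y)) : rl_mul (r *: t) = j r * rl_mul t.
Proof.
move: t; apply: tlift_eq => [s t|s t|m n]; rewrite ?scalerDr ?rl_mulD ?mulrDr //.
by rewrite scale_tens !rl_mulE (rlZ fP) mulrA.
Qed.

Let rl_mulR x y (t : tensor (F x) (F y)) r : rl_mul (t :* r) = rl_mul t * j r.
Proof.
move: t; apply: tlift_eq => [s t|s t|m n]; rewrite ?rscalerDl ?rl_mulD ?mulrDl //.
by rewrite tens_rscaleE !rl_mulE (rlR fP) mulrA.
Qed.

Let rl_mul_homog x y (t : tensor (F x) (F y)) : homog L (x * y)%g (rl_mul t).
Proof.
move: t; apply: tens_ind => [|s t|m n].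
- by rewrite (morphD0 (@rl_mulD x y)); apply: homog_0.
- by rewrite rl_mulD; apply: homog_D.
- by rewrite rl_mulE; apply: homog_M; apply: rl_homog.
Qed.

Let rl_mul_surj x y a : homog L (x * y)%g a ->
  exists t : tensor (F x) (F y), rl_mul t = a.
Proof.
rewrite -homog_strong => -[n [b [c [Lb Lc ->]]]].
have /choice[m mb] i : exists m : F x, f m = b i by apply: rl_surj (Lb i).
have /choice[l lc] i : exists l : F y, f l = c i by apply: rl_surj (Lc i).
exists (\sum_i m i *t l i); rewrite (morphD_sum (@rl_mulD x y)).
by apply: eq_bigr => i _; rewrite rl_mulE mb lc.
Qed.

Lemma rl_comparison : exists u : Gh -> Gh -> UZ R, forall x y (m : F x) (n : F y),
  f m * f n = j (val (u x y)) * f (fs_mu (m *t n)).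
Proof.
suff /choice[u uP] : forall p : Gh * Gh, exists u : UZ R,
    forall (m : F p.1) (n : F p.2), f m * f n = j (val u) * f (fs_mu (m *t n)).
  by exists (fun x y => u (x, y)) => x y; apply: (uP (x, y)).
case=> x y; have mI := fs_mu_iso F x y; have [_ mR mB] := mI.
have [|||||||||||u uP] := @comparison_unit _ _ _ _ L (tensor (F x) (F y)) (x * y)%g
  (fun t => f (fs_mu t)) (@rl_mul x y).
- by move=> s t /=; rewrite (linD mI) (rlD fP).
- exact: rl_mulD.
- by move=> r t; rewrite (linZ mI) (rlZ fP).
- exact: rl_mulZ.
- by move=> t r; rewrite mR (rlR fP).
- exact: rl_mulR.
- by move=> s t /(rl_inj fP) /(bij_inj mB).
- move=> a /(rl_surj fP)[m <-]; have [m' _ mK] := mB.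
  by exists (m' m); rewrite mK.
- by move=> t; apply: rl_homog.
- exact: rl_mul_homog.
- exact: rl_mul_surj.
- by exists u => m n; rewrite -uP rl_mulE.
Qed.

Lemma rl_one r :
  f (transport (M := fs_mod F) (val1 G) (fs_emb F (r : comp_bimod S 1%g))) = j r.
Proof. by rewrite rl_transport (rl_emb fP). Qed.

(** The scalars [u] that compare the two products are a relative cochain, and
    associativity of the ring turns [is_associator] into [alpha = d u]. *)
Lemma rl_associator alpha : is_associator F alpha ->
  exists b : cochain Gh (UZ R) 2,
    relative_cochain P b /\ forall t, alpha t = coboundary (hat_act ph) b t.
Proof.
move=> Fa; have [u uE] := rl_comparison.
pose b : cochain Gh (UZ R) 2 := fun t => u (thead t) (tnth t (lift ord0 ord0)).
have bE x y : b [tuple x; y] = u x y by [].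
exists b; split; first split.
- move=> t; have [x [y ->]] := tuple2E t; rewrite bE !inE.
  case/orP=> /eqP <-.
    apply: (@rl_UZ_inj y) => m.
    have := uE _ _ (transport (M := fs_mod F) (val1 G)
      (fs_emb F ((1 : R) : comp_bimod S 1%g))) m.
    by rewrite fs_mu1x scale1r rl_one rl_transport lift_base1 mul1r => <-.
  apply: (@rl_UZ_inj x) => m.
  have := uE _ _ m (transport (M := fs_mod F) (val1 G)
    (fs_emb F ((1 : R) : comp_bimod S 1%g))).
  by rewrite fs_mux1 rscaler1 rl_one rl_transport lift_base1 mulr1 mul1r => <-.
- move=> t; have [x [y ->]] := tuple2E t; rewrite bE => tP.
  have Px : x \in P by apply: tP; rewrite mem_head.
  have Py : y \in P by apply: tP; rewrite !inE eqxx orbT.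
  pose g : G := Sub x Px; have gx : val g = x by apply: SubK.
  pose h : G := Sub y Py; have hy : val h = y by apply: SubK.
  rewrite -gx -hy; apply/val_inj/(@lift_base_inj _ _ _ _ L)/eqP.
  rewrite -subr_eq0; apply/eqP/(@rl_faithful (val g)) => m.
  apply: (@rl_faithful (val h)) => n.
  have [_ _ [g' _ gK]] := fs_emb_iso F g; have [_ _ [h' _ hK]] := fs_emb_iso F h.
  rewrite -(gK m) -(hK n) !mulrBl -!mulrA.
  have muE : f (fs_mu (fs_emb F (g' m) *t fs_emb F (h' n))) =
      f (fs_emb F (g' m)) * f (fs_emb F (h' n)).
    by rewrite fs_mu_emb rl_transport !(rl_emb fP) /= rmorphM.
  by rewrite -{1}muE -uE lift_base0UZ mul1r subrr.
- move=> t; have [x [y [z ->]]] := tuple3E t; rewrite coboundary2E !bE.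
  (* A triple product bracketed to the left gives s1, to the right s2. *)
  set s1 := u x y + u (x * y)%g z + alpha [tuple x; y; z].
  set s2 := hat_act ph x (u y z) + u x (y * z)%g.
  suff s12 : s1 = s2.
    rewrite [X in _ = X - _]addrAC -/s2 -s12 /s1 -addrA -opprD.
    by rewrite [u (x * y)%g z + u x y]addrC addrC addKr.
  have e1 (m : F x) (n : F y) (l : F z) :
      f m * f n * f l = j (val s1) * f (fs_mu (m *t fs_mu (n *t l))).
    rewrite uE -mulrA uE Fa rl_transport (rlZ fP).
    by rewrite !lift_baseUZD !mulrA.
  have e2 (m : F x) (n : F y) (l : F z) :
      f m * f n * f l = j (val s2) * f (fs_mu (m *t fs_mu (n *t l))).
    rewrite -mulrA uE mulrA rl_act -mulrA uE.
    by rewrite !lift_baseUZD !mulrA.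
  apply/val_inj/(@lift_base_inj _ _ _ _ L)/eqP; rewrite -subr_eq0; apply/eqP.
  apply: (@rl_faithful x) => m; apply: (@rl_faithful y) => n.
  apply: (@rl_faithful z) => l; rewrite !mulrBl -!mulrA !(mulrA (f m)).
  (* Expanding crosswise makes both sides multiples by the product of s1 and s2. *)
  rewrite {1}e2 {1}e1 !mulrA -!lift_baseM.
  have -> : val s1 * val s2 = val s2 * val s1 by have [-> _] := UZP s1.
  exact: subrr.
Qed.

End Theory.
End Realization.

Section LiftFactorSystem.
Variables (Gh : groupType) (P : {pred Gh}) (G : subGroupType P).
Variables (S : stronglyGraded G) (ph : Gh -> Pic (principal S)) (L : graded_lift S).
Local Notation R := (principal S).
Local Notation j := (lift_base L).

Definition lift_mul x y : tensor (lift_bimod L x) (lift_bimod L y) ->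
    lift_bimod L (x * y)%g :=
  tlift (fun (m : lift_bimod L x) (n : lift_bimod L y) =>
    homog_mul (m : component L x) (n : component L y)
    : lift_bimod L (x * y)%g).

Fact lift_mul_balanced x y :
  balanced (fun (m : lift_bimod L x) (n : lift_bimod L y) =>
    homog_mul (m : component L x) (n : component L y) : lift_bimod L (x * y)%g).
Proof.
by split=> [n a b|m a b|m r n]; apply: val_inj; rewrite /= ?mulrDl ?mulrDr ?mulrA.
Qed.

Lemma lift_mulD x y : {morph @lift_mul x y : s t / s + t}.
Proof. exact: tliftD (@lift_mul_balanced x y). Qed.

Lemma lift_mulE x y (m : lift_bimod L x) (n : lift_bimod L y) :
  val (lift_mul (m *t n)) = val m * val n.
Proof. by rewrite /lift_mul (tliftE (@lift_mul_balanced x y)). Qed.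

Lemma lift_bimod_transport x y (e : x = y) (m : lift_bimod L x) :
  val (transport (M := lift_bimod L) e m) = val m.
Proof. by case: y / e. Qed.

(** The inverse is c |-> sum_i c a_i (x) b_i, where 1 = sum_i a_i b_i with a_i of
    degree y^-1 and b_i of degree y.  On m (x) k it gives m (x) k, because
    k a_i lies in the base ring and passes through the tensor sign. *)
Lemma lift_mul_iso x y : is_bimod_iso (@lift_mul x y).
Proof.
have lmZ r t : lift_mul (r *: t) = r *: @lift_mul x y t.
  move: t; apply: tlift_eq => [s t|s t|m n];
    rewrite ?scalerDr ?lift_mulD ?scalerDr // scale_tens.
  by apply: val_inj; rewrite /= !lift_mulE /= mulrA.
split=> [r s t|t r|]; first by rewrite lift_mulD lmZ.
  move: t; apply: tlift_eq => [s t|s t|m n];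
    rewrite ?rscalerDl ?lift_mulD ?rscalerDl // tens_rscaleE.
  by apply: val_inj; rewrite /= !lift_mulE /= mulrA.
have [n [a [b [La Lb ab1]]]] := homog_unit_sum L y^-1%g.
rewrite invgK in Lb.
have Lca (c : component L (x * y)%g) i : homog L x (val c * a i).
  by have := homog_M (componentP c) (La i); rewrite mulgK.
pose ca (c : lift_bimod L (x * y)%g) i : lift_bimod L x := to_component (Lca c i).
exists (fun c => \sum_i ca c i *t (to_component (Lb i) : lift_bimod L y)).
  apply: tlift_eq => [s t|//|m k].
    rewrite -big_split; apply: eq_bigr => i _ /=; rewrite -tensDl; congr (_ *t _).
    by apply: val_inj; rewrite /= lift_mulD mulrDl.
  have /choice[c jc] i : exists c, j c = val k * a i.
    apply: lift_base_surj; rewrite -(mulgV y).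
    by apply: homog_M => //; apply: componentP.
  transitivity (\sum_i m *t (c i *: (to_component (Lb i) : lift_bimod L y))).
    apply: eq_bigr => i _; rewrite -tensM; congr (_ *t _); apply: val_inj.
    by rewrite /= lift_mulE jc mulrA.
  rewrite -(morphD_sum (tensDr m)); congr (_ *t _); apply: val_inj.
  rewrite (morphD_sum (f := val)) // -[RHS]mulr1 ab1 mulr_sumr.
  by apply: eq_bigr => i _; rewrite /= jc mulrA.
move=> c; apply: val_inj; rewrite (morphD_sum (@lift_mulD x y)).
rewrite (morphD_sum (f := val)) // -[RHS]mulr1 ab1 mulr_sumr.
by apply: eq_bigr => i _; rewrite lift_mulE /= mulrA.
Qed.

Hypothesis phL : forall x, pic_class (ph x) = iso_class (lift_bimod L x).

Fact lift_class x : pic_class (ph x) (lift_bimod L x).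
Proof. by rewrite phL; apply: bimod_iso_refl. Qed.

Fact lift_mul_emb (g h : G) (s : comp_bimod S g) (t : comp_bimod S h) :
  lift_mul (lift_emb_component L s *t lift_emb_component L t) =
  transport (M := lift_bimod L) (valM g h) (lift_emb_component L (homog_mul s t)).
Proof.
by apply: val_inj; rewrite lift_mulE lift_bimod_transport /= rmorphM.
Qed.

Fact lift_mul1x x (r : R) (m : lift_bimod L x) :
  lift_mul (transport (M := lift_bimod L) (val1 G)
    (lift_emb_component L (r : comp_bimod S 1%g)) *t m) =
  transport (M := lift_bimod L) (esym (mul1g x)) (r *: m).
Proof. by apply: val_inj; rewrite lift_mulE !lift_bimod_transport. Qed.

Fact lift_mulx1 x (m : lift_bimod L x) (r : R) :
  lift_mul (m *t transport (M := lift_bimod L) (val1 G)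
    (lift_emb_component L (r : comp_bimod S 1%g))) =
  transport (M := lift_bimod L) (esym (mulg1 x)) (m :* r).
Proof. by apply: val_inj; rewrite lift_mulE !lift_bimod_transport. Qed.

Definition lift_factor_system : factor_system ph :=
  FactorSystem lift_class (@lift_emb_component_iso _ _ _ _ L) lift_mul_iso
    lift_mul_emb lift_mul1x lift_mulx1.

Lemma lift_associator : is_associator lift_factor_system (fun=> 0).
Proof.
move=> x y z m n l; rewrite scale1r; apply: val_inj.
by rewrite lift_bimod_transport !lift_mulE mulrA.
Qed.

End LiftFactorSystem.

(** [rl_associator] puts every element of the characteristic class in the zero
    class; the converse inclusion comes from the factor system of the lift. *)
Lemma char_class_of_lift (Gh : groupType) (P : {pred Gh}) (G : subGroupType P)
    (S : stronglyGraded G) (ph : Gh -> Pic (principal S)) (L : graded_lift S) :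
  (forall x, pic_class (ph x) = iso_class (lift_bimod L x)) ->
  char_class ph = zero_class ph.
Proof.
move=> phL; apply/seteqP; split=> c.
  case=> F [alpha [Fa [b [b1 bP] cb]]].
  have [f fP] := realization_exists F phL; have [a [[a1 aP] aE]] := rl_associator fP Fa.
  exists (fun t => a t + b t) => [|t].
    by split=> t tP; [rewrite a1 ?b1 ?addr0 | rewrite aP ?bP ?addr0].
  rewrite cb aE add0r coboundary2D // => x; exact: pic_actD.
case=> b b1 cb; exists (lift_factor_system phL), (fun=> 0); split; last by exists b.
exact: lift_associator.
Qed.

(** * Twisting a factor system by a cochain *)

Section Twist.
Variables (Gh : groupType) (P : {pred Gh}) (G : subGroupType P).
Variables (S : stronglyGraded G) (ph : Gh -> Pic (principal S)).
Variables (F : factor_system ph) (b : cochain Gh (UZ (principal S)) 2).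
Hypothesis bP : relative_cochain P b.
Local Notation R := (principal S).

(** Multiplying the products of a factor system by a relative 2-cochain: the
    normalization of the cochain preserves the unit laws, and its triviality on
    the subgroup preserves the product of [S]. *)
Definition twist_mu x y (t : tensor (F x) (F y)) : F (x * y)%g :=
  val (b [tuple x; y]) *: fs_mu t.

Fact twist_mu_iso x y : is_bimod_iso (@twist_mu x y).
Proof. exact/UZ_scale_iso/fs_mu_iso. Qed.

Fact twist_mu_emb (g h : G) (s : comp_bimod S g) (t : comp_bimod S h) :
  twist_mu (fs_emb F s *t fs_emb F t) =
  transport (M := fs_mod F) (valM g h) (fs_emb F (homog_mul s t)).
Proof.
rewrite /twist_mu fs_mu_emb bP.2 ?scale1r // => x.
by rewrite !inE => /orP[] /eqP->; apply: valP.
Qed.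

Fact twist_mu1x x (r : R) (m : F x) :
  twist_mu (transport (M := fs_mod F) (val1 G) (fs_emb F (r : comp_bimod S 1%g)) *t m) =
  transport (M := fs_mod F) (esym (mul1g x)) (r *: m).
Proof. by rewrite /twist_mu fs_mu1x bP.1 ?scale1r // mem_head. Qed.

Fact twist_mux1 x (m : F x) (r : R) :
  twist_mu (m *t transport (M := fs_mod F) (val1 G) (fs_emb F (r : comp_bimod S 1%g))) =
  transport (M := fs_mod F) (esym (mulg1 x)) (m :* r).
Proof. by rewrite /twist_mu fs_mux1 bP.1 ?scale1r // !inE eqxx orbT. Qed.

Definition twist : factor_system ph :=
  FactorSystem (fs_mod_class F) (fs_emb_iso F) twist_mu_iso
    twist_mu_emb twist_mu1x twist_mux1.

Lemma twist_associator alpha : is_associator F alpha ->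
  is_associator twist (fun t => alpha t - coboundary (hat_act ph) b t).
Proof.
move=> Fa x y z.
suff twistA (m : F x) (n : F y) (l : F z) :
    twist_mu (twist_mu (m *t n) *t l) = transport (M := fs_mod F) (mulgA x y z)
      (val (alpha [tuple x; y; z] - coboundary (hat_act ph) b [tuple x; y; z]) *:
       twist_mu (m *t twist_mu (n *t l))) by exact: twistA.
have muZ x' y' r (m' : F x') (n' : F y') : fs_mu ((r *: m') *t n') = r *: fs_mu (m' *t n').
  by rewrite -scale_tens (linZ (fs_mu_iso F x' y')).
rewrite /twist_mu muZ Fa !scalerA transport_scale.
apply: (congr1 (transport (M := fs_mod F) (mulgA x y z))).
rewrite -tensM (pic_actP _ (fs_mod_class F x)) muZ !scalerA; congr (_ *: _).
rewrite coboundary2E.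
rewrite -/(hat_act ph x (b [tuple y; z])).
set u := alpha _; set b1 := b [tuple _; z]; set b2 := b [tuple x; y].
set b3 := b [tuple x; _]; set b4 := hat_act _ _ _.
rewrite -!UZ_valD; congr val.
have -> : b4 - b1 + b3 - b2 = (b4 + b3) - (b1 + b2) by rewrite -addrA addrACA opprD.
by rewrite opprB -2![RHS]addrA (addrC b3) subrK addrC.
Qed.

End Twist.

(** * The crossed product of a factor system with trivial associator *)

Section CrossedProduct.
Variables (Gh : groupType) (P : {pred Gh}) (G : subGroupType P).
Variables (S : stronglyGraded G) (ph : Gh -> Pic (principal S)).
Variables (F : factor_system ph) (Fa : is_associator F (fun=> 0)).
Local Notation R := (principal S).

Definition fs_zmod (x : Gh) : zmodType := fs_mod F x.

(** The direct sum of the modules.  The proof that the associator is trivial is an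
    argument, so that the ring structure can be attached to the type. *)
Definition crossed of is_associator F (fun=> 0) := dsum fs_zmod.
Local Notation C := (crossed Fa).
HB.instance Definition _ := GRing.Zmodule.on C.

Definition cinj (x : Gh) (m : F x) : C := dinj (M := fs_zmod) m.

Lemma cinjD x : {morph @cinj x : m n / m + n}.
Proof. exact: dinjD. Qed.

Lemma cinj_transport x y (e : x = y) (m : F x) :
  cinj (transport (M := fs_mod F) e m) = cinj m.
Proof. exact: dinj_transport. Qed.

Lemma crossed_eq (V : zmodType) (f g : C -> V) :
  {morph f : x y / x + y} -> {morph g : x y / x + y} ->
  (forall x (m : F x), f (cinj m) = g (cinj m)) -> f =1 g.
Proof. exact: dsum_eq. Qed.

Definition cmul1 x (m : F x) (g : C) : C :=
  dlift (fun y (n : fs_zmod y) => cinj (fs_mu (m *t (n : F y)))) g.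

Definition crossed_mul (f g : C) : C := dlift (fun x (m : fs_zmod x) => cmul1 m g) f.

Lemma cmul1D x (m : F x) : {morph cmul1 m : f g / f + g}.
Proof.
apply: dliftD => y n n'.
by rewrite tensDr (linD (fs_mu_iso F x y)) cinjD.
Qed.

Lemma cmul1Dl x g : {morph (@cmul1 x)^~ g : m n / m + n}.
Proof.
move=> m n; rewrite /cmul1 -dliftDl; apply: eq_bigr => y _.
by rewrite tensDl (linD (fs_mu_iso F x y)) cinjD.
Qed.

Lemma crossed_mulDl : left_distributive crossed_mul +%R.
Proof. by move=> f g h; apply: dliftD => x; apply: cmul1Dl. Qed.

Lemma crossed_mulDr : right_distributive crossed_mul +%R.
Proof.
move=> f g h; rewrite /crossed_mul -dliftDl; apply: eq_bigr => x _.
exact: cmul1D.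
Qed.

Lemma crossed_mulE x y (m : F x) (n : F y) :
  crossed_mul (cinj m) (cinj n) = cinj (fs_mu (m *t n)).
Proof.
rewrite /crossed_mul dlift_dinj => [|z]; last exact: cmul1Dl.
rewrite /cmul1 dlift_dinj // => z n1 n2.
by rewrite tensDr (linD (fs_mu_iso F x z)) cinjD.
Qed.

(** The elements of degree one, as images of the base ring under the embedding of
    the principal component.  They live in degree [val 1], which equals [1]
    propositionally only. *)
Definition cunit (r : R) : C := cinj (fs_emb F (r : comp_bimod S 1%g)).

Lemma crossed_mulZ x r (m : F x) : crossed_mul (cunit r) (cinj m) = cinj (r *: m).
Proof.
rewrite /cunit -(cinj_transport (val1 G)) crossed_mulE fs_mu1x.
exact: cinj_transport.
Qed.

Lemma crossed_mulR x (m : F x) r : crossed_mul (cinj m) (cunit r) = cinj (m :* r).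
Proof.
rewrite /cunit -(cinj_transport (val1 G)) crossed_mulE fs_mux1.
exact: cinj_transport.
Qed.

(** By additivity it suffices to consider homogeneous elements, for which
    associativity is the triviality of the associator. *)
Fact crossed_mulA : associative crossed_mul.
Proof.
move=> f g h; move: f; apply: crossed_eq => [f f'|f f'|x m].
- exact: crossed_mulDl.
- by rewrite !crossed_mulDl.
move: g; apply: crossed_eq => [g g'|g g'|y n].
- by rewrite crossed_mulDl crossed_mulDr.
- by rewrite crossed_mulDr crossed_mulDl.
move: h; apply: crossed_eq => [h h'|h h'|z l].
- by rewrite !crossed_mulDr.
- by rewrite crossed_mulDr.
by rewrite !crossed_mulE Fa cinj_transport scale1r.
Qed.

Fact crossed_mul1 : left_id (cunit 1) crossed_mul.
Proof.
apply: crossed_eq => [f g|//|x m]; first exact: crossed_mulDr.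
by rewrite crossed_mulZ scale1r.
Qed.

Fact crossed_mulr1 : right_id (cunit 1) crossed_mul.
Proof.
apply: crossed_eq => [f g|//|x m]; first exact: crossed_mulDl.
by rewrite crossed_mulR rscaler1.
Qed.

HB.instance Definition _ := GRing.Zmodule_isPzRing.Build C
  crossed_mulA crossed_mul1 crossed_mulr1 crossed_mulDl crossed_mulDr.

Lemma cinjM x y (m : F x) (n : F y) : cinj m * cinj n = cinj (fs_mu (m *t n)).
Proof. exact: crossed_mulE. Qed.

Lemma cunitM x r (m : F x) : cunit r * cinj m = cinj (r *: m).
Proof. exact: crossed_mulZ. Qed.

Lemma cinjM_unit x (m : F x) r : cinj m * cunit r = cinj (m :* r).
Proof. exact: crossed_mulR. Qed.

Lemma cinj_inj x : injective (@cinj x).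
Proof. exact: dinj_inj. Qed.

Definition crossed_homog (x : Gh) : set C := range (@cinj x).

Fact crossed_grading : is_grading crossed_homog.
Proof.
split=> [x|x _ _ [m _ <-] [n _ <-]|f|s f us fs s0 x xs|x y _ _ [m _ <-] [n _ <-]].
- by exists 0; rewrite ?(morphD0 (@cinjD x)).
- by exists (m - n); rewrite ?(morphDB (@cinjD x)).
- exists (dsupp f), (fun x => cinj (dcoord f x)); split.
  + exact: undup_uniq.
  + by move=> x; exists (dcoord f x).
  + exact: (dsum_expand f).
- have /dep_choice[m mf] y : exists m : F y, cinj m = f y.
    by have [m _ mf] := fs y; exists m.
  rewrite -mf; have := congr1 (fun g : C => dcoord g x) s0.
  rewrite (morphD_sum (f := fun g : C => dcoord g x)) //.
  rewrite (bigD1_seq x) //= -mf [X in X + _ = _]dcoord_dinj big1 => [|y yx].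
    by rewrite addr0 => ->; apply: (morphD0 (@cinjD x)).
  by rewrite -mf; apply: dcoord_dinj0.
- by exists (fs_mu (m *t n)); rewrite ?cinjM.
Qed.

Fact crossed_strong x y :
  prod_set (crossed_homog x) (crossed_homog y) = crossed_homog (x * y)%g.
Proof.
apply/seteqP; split=> [_ [n [a [b [xa yb ->]]]]|_ [m _ <-]].
  have [h0 hB _ _ hM] := crossed_grading.
  apply: big_ind => [|c d hc hd|i _]; [exact: h0 | | exact: hM].
  by rewrite -[d]opprK -[- d]sub0r; apply/hB/hB.
have [_ _ [g _ gK]] := fs_mu_iso F x y; rewrite -(gK m).
move: (g m); apply: tens_ind => [|s t|m1 n1].
- rewrite (morphD0 (linD (fs_mu_iso F x y))) (morphD0 (@cinjD _)).
  exact: prod_set_0.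
- by rewrite (linD (fs_mu_iso F x y)) cinjD; apply: prod_set_D.
exists 1%N, (fun=> cinj m1), (fun=> cinj n1); split=> [i|i|].
- by exists m1.
- by exists n1.
- by rewrite big_ord1 cinjM.
Qed.

Definition crossed_graded : stronglyGraded Gh :=
  StronglyGraded crossed_grading crossed_strong.

(** The isomorphisms [fs_emb], on the homogeneous components, extend to [S] by
    the universal property of its grading. *)
Lemma crossed_emb_exists : exists f : S -> crossed_graded,
  {morph f : a b / a + b} /\
  forall (g : G) (s : component S g), f (val s) = cinj (fs_emb F (s : comp_bimod S g)).
Proof.
have [coords sK _] := @gr_sum_bij _ S.
have [coords' s'K sK'] := @gr_sum_bij _ S.
pose e (f : dsum (component S)) : crossed_graded :=
  dlift (fun g (s : component S g) => cinj (fs_emb F (s : comp_bimod S g))) f.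
have eD : {morph e : f g / f + g}.
  by apply: dliftD => g s t; rewrite (linD (fs_emb_iso F g)) cinjD.
exists (e \o coords'); split=> [a b|g s] /=.
  rewrite -eD; congr e; apply: (can_inj s'K).
  by rewrite gr_sumD !sK'.
rewrite -gr_sum_dinj s'K /e dlift_dinj // => h t u.
by rewrite (linD (fs_emb_iso F h)) cinjD.
Qed.
Definition crossed_emb : S -> crossed_graded := projT1 (cid crossed_emb_exists).

Lemma crossed_embD : {morph crossed_emb : a b / a + b}.
Proof. exact: (projT2 (cid crossed_emb_exists)).1. Qed.

Lemma crossed_embE (g : G) (s : component S g) :
  crossed_emb (val s) = cinj (fs_emb F (s : comp_bimod S g)).
Proof. exact: (projT2 (cid crossed_emb_exists)).2. Qed.

Fact crossed_emb_zmod : zmod_morphism crossed_emb.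
Proof. exact: morphDB crossed_embD. Qed.

Fact crossed_emb_monoid : monoid_morphism crossed_emb.
Proof.
split; first by have := crossed_embE (1 : R); exact.
move=> a b; move: a; apply: homog_ind => [|a a'|g s].
- by rewrite mul0r (morphD0 crossed_embD) mul0r.
- by rewrite mulrDl !crossed_embD mulrDl => -> ->.
move: b; apply: homog_ind => [|b b'|h t].
- by rewrite mulr0 (morphD0 crossed_embD) mulr0.
- by rewrite mulrDr !crossed_embD mulrDr => -> ->.
rewrite (crossed_embE (homog_mul s t)) !crossed_embE [RHS]cinjM fs_mu_emb.
by rewrite cinj_transport.
Qed.

HB.instance Definition _ :=
  GRing.isZmodMorphism.Build S crossed_graded crossed_emb crossed_emb_zmod.
HB.instance Definition _ :=
  GRing.isMonoidMorphism.Build S crossed_graded crossed_emb crossed_emb_monoid.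

(** The embedding is diagonal with respect to the gradings; its injectivity
    reduces to that of the components. *)
Lemma crossed_emb_coord (f : dsum (component S)) (g : G) :
  dcoord (crossed_emb (gr_sum f)) (val g) = fs_emb F (dcoord f g : comp_bimod S g).
Proof.
have eD := linD (fs_emb_iso F g).
move: f; apply: dsum_eq => [f f'|f f'|h s].
- by rewrite gr_sumD crossed_embD.
- by rewrite dcoordD eD.
rewrite gr_sum_dinj crossed_embE; have [<-|hg] := eqVneq h g.
  by rewrite !dcoord_dinj.
rewrite !dcoord_dinj0 // ?(morphD0 eD) //.
by apply: contraNneq hg => /val_inj ->.
Qed.

Fact crossed_emb_inj : injective crossed_emb.
Proof.
apply: (morphD_inj crossed_embD) => a.
have [coords _ sK] := @gr_sum_bij _ S; rewrite -(sK a) => a0.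
suff -> : coords a = 0 by exact: (morphD0 (@gr_sumD _ S)).
apply: dsum_ext => g; have [_ _ /bij_inj e_inj] := fs_emb_iso F g; apply: e_inj.
by rewrite -crossed_emb_coord a0 (morphD0 (linD (fs_emb_iso F g))).
Qed.

Fact crossed_emb_homog (g : G) :
  homog crossed_graded (val g) = crossed_emb @` homog S g.
Proof.
have [_ _ [e' _ eK]] := fs_emb_iso F g.
apply/seteqP; split=> [_ [m _ <-]|_ [a Sa <-]].
  exists (val (e' m)); first exact: componentP.
  by rewrite crossed_embE; congr cinj; rewrite -[RHS]eK.
by rewrite (crossed_embE (to_component Sa)); exists (fs_emb F (to_component Sa : comp_bimod S g)).
Qed.

Definition crossed_lift : graded_lift S :=
  @GradedLift _ _ _ _ crossed_graded crossed_emb crossed_emb_inj crossed_emb_homog.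

Lemma crossed_realization : realization (L := crossed_lift) cinj.
Proof.
have jE r : lift_base crossed_lift r = cunit r by exact: (crossed_embE (r : component S 1%g)).
split=> [x m n|x r m|x m r|x m|x|x a [m _ ma]|g s].
- exact: cinjD.
- by rewrite jE [RHS]cunitM.
- by rewrite jE [RHS]cinjM_unit.
- by exists m.
- exact: cinj_inj.
- by exists m.
- by rewrite [RHS]crossed_embE.
Qed.

End CrossedProduct.

(** Triviality of the class puts the trivial cochain in the characteristic class,
    which provides a factor system with associator -d b for a relative cochain
    b; twisting it by -b makes the associator trivial. *)
Lemma lift_of_trivial_class (Gh : groupType) (P : {pred Gh}) (G : subGroupType P)
    (S : stronglyGraded G) (ph : Gh -> Pic (principal S)) :
  char_class ph = zero_class ph ->
  exists L : graded_lift S,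
    forall x, pic_class (ph x) = iso_class (lift_bimod L x).
Proof.
move=> ch0; have actD x : {morph hat_act ph x : u v / u + v} by apply: pic_actD.
have : zero_class ph (fun=> 0).
  exists (fun=> 0) => [|t]; first by split.
  have [x [y [z ->]]] := tuple3E t; rewrite coboundary2E (morphD0 (actD x)).
  by rewrite !subr0 !addr0.
rewrite -ch0 => -[F [alpha [Fa [b bP ab]]]].
have Nb : relative_cochain P (fun t => - b t : UZ (principal S)).
  by case: bP => b1 bG; split=> t tP; [rewrite b1 ?oppr0 | rewrite bG ?oppr0].
have T0 : is_associator (@twist _ _ _ _ _ F _ Nb) (fun=> 0).
  have := @twist_associator _ _ _ _ _ F _ Nb _ Fa; congr is_associator.
  by apply: funext => t; rewrite coboundary2N // opprK -ab.
exists (crossed_lift T0); exact: rl_class (crossed_realization T0).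
Qed.

Theorem theorem3p5 (Gh : groupType) (P : {pred Gh}) (G : subGroupType P)
    (S : stronglyGraded G) (ph : Gh -> Pic (principal S)) :
  is_pic_hom ph ->
  (forall g : G, pic_class (ph (val g)) = iso_class (comp_bimod S g)) ->
  (exists L : graded_lift S,
     forall x : Gh, pic_class (ph x) = iso_class (lift_bimod L x)) <->
  char_class ph = zero_class ph.
Proof.
move=> _ _; split=> [[L phL]|]; first exact: char_class_of_lift phL.
exact: lift_of_trivial_class.
Qed.
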